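(* Let $N\in\mathbb N$, $\alpha,\beta>-1$, and let $\{x_j,\omega_j\}_{j=0}^N$ be the JGL nodes and weights. Then for $\mu\in(0,1)$ and $0\le i,j\le N$, $$ {}^C\mathbf D^{(\mu)}_{ij}=(1+x_i)^{1-\mu}\sum_{l=1}^N\frac{(l-1)!}{\Gamma(l+1-\mu)}\,s_{lj}\,P_{l-1}^{(\mu-1,1-\mu)}(x_i), $$ where $$ s_{lj}=\frac12\sum_{n=l-1}^N (n+\alpha+\beta+1)\,{}^{(\alpha+1,\beta+1)}C^{(0,0)}_{l-1,n-1}\,t_{nj},\qquad t_{nj}=\frac{\omega_j}{\tilde\gamma_n^{(\alpha,\beta)}}P_n^{(\alpha,\beta)}(x_j) $$ (terms with $n-1<0$ are omitted). In particular, for $\alpha=\beta=0$ one may equivalently take $$ s_{lj}=\frac{2l-1}{2}\Big\{\delta_{jN}+(-1)^l\delta_{j0}-\omega_jP_{l-1}'(x_j)\Big\}. $$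
   Context: For $\rho>0$, $(I_-^\rho u)(x)=\frac{1}{\Gamma(\rho)}\int_{-1}^x (x-y)^{\rho-1}u(y)\,dy$; for $\mu\in(0,1)$ the Caputo derivative is ${}^C D_-^\mu u=I_-^{1-\mu}(u')$. Jacobi polynomials are in Szegő's normalization: $P_n^{(\alpha,\beta)}(x)=\frac{\Gamma(n+\alpha+1)}{n!\Gamma(\alpha+1)}\,{}_2F_1\big(-n,n+\alpha+\beta+1;\alpha+1;\tfrac{1-x}{2}\big)$, $P_0^{(\alpha,\beta)}=1$, and $P_n=P_n^{(0,0)}$ (Legendre). For $\alpha,\beta>-1$, $\gamma_n^{(\alpha,\beta)}=\frac{2^{\alpha+\beta+1}\Gamma(n+\alpha+1)\Gamma(n+\beta+1)}{(2n+\alpha+\beta+1)\,n!\,\Gamma(n+\alpha+\beta+1)}$ is the squared norm of $P_n^{(\alpha,\beta)}$ in $L^2$ with weight $(1-x)^\alpha(1+x)^\beta$; $\tilde\gamma_n^{(\alpha,\beta)}=\gamma_n^{(\alpha,\beta)}$ for $0\le n\le N-1$ and $\tilde\gamma_N^{(\alpha,\beta)}=\big(2+\frac{\alpha+\beta+1}{N}\big)\gamma_N^{(\alpha,\beta)}$. Connection coefficients: for $\alpha,\beta,a,b>-1$, ${}^{(\alpha,\beta)}C^{(a,b)}_{ln}$ are the unique numbers with $P_n^{(\alpha,\beta)}=\sum_{l=0}^n {}^{(\alpha,\beta)}C^{(a,b)}_{ln}P_l^{(a,b)}$ (and they are $0$ for $l>n$). The JGL nodes $x_0<\dots<x_N$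 are the zeros of $(1-x^2)\frac{d}{dx}P_N^{(\alpha,\beta)}$ ($x_0=-1$, $x_N=1$), and the weights $\omega_j$ make $\int_{-1}^1\phi(x)(1-x)^\alpha(1+x)^\beta dx=\sum_j\phi(x_j)\omega_j$ exact for all $\phi\in\mathcal P_{2N-1}$. $h_j\in\mathcal P_N$ is the Lagrange basis polynomial ($h_j(x_i)=\delta_{ij}$), and ${}^C\mathbf D^{(\mu)}_{ij}=({}^C D_-^\mu h_j)(x_i)$, with the value at $x_0=-1$ understood as the limit. *)

(* Defs.v *)
From Stdlib Require Import Reals Lra Arith ClassicalEpsilon Factorial.
Open Scope R_scope.

Fixpoint rsum (n : nat) (f : nat -> R) : R :=
  match n with O => 0 | S m => rsum m f + f m end.
Fixpoint rprod (n : nat) (f : nat -> R) : R :=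
  match n with O => 1 | S m => rprod m f * f m end.

Definition Rlim (u : nat -> R) : R :=
  epsilon (inhabits 0) (fun l => Un_cv u l).

(* Euler's Gamma function, via the Euler-Gauss product limit
   Gamma(z) = lim n! n^z / (z (z+1) ... (z+n)) *)
Definition Gamma (z : R) : R :=
  Rlim (fun n => INR (fact n) * Rpower (INR n) z / rprod (S n) (fun k => z + INR k)).

(* x^y for x >= 0, with 0^y = 0 (used only for y > 0) *)
Definition powr (x y : R) : R := if Rlt_dec 0 x then Rpower x y else 0.

Definition poch (a : R) (k : nat) : R := rprod k (fun i => a + INR i).

(* Jacobi polynomial, Szego normalization, via the terminating 2F1 *)
Definition jacobi (a b : R) (n : nat) (y : R) : R :=
  poch (a + 1) n / INR (fact n) *
  rsum (S n) (fun k => poch (- INR n) k * poch (INR n + a + b + 1) k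
                        / (poch (a + 1) k * INR (fact k)) * ((1 - y) / 2) ^ k).

Definition improper_int (f : R -> R) (a b v : R) : Prop :=
  forall eps, 0 < eps -> exists delta, 0 < delta /\
    forall c d, a < c < a + delta -> b - delta < d < b -> c <= d ->
      exists pr : Riemann_integrable f c d, Rabs (RiemannInt pr - v) < eps.

(* Riemann-Liouville integral (I_-^rho f)(x) = v, for x > -1 *)
Definition is_frac_int (rho : R) (f : R -> R) (x v : R) : Prop :=
  exists I, improper_int (fun y => Rpower (x - y) (rho - 1) * f y) (-1) x I
            /\ v = I / Gamma rho.

Definition is_caputo (mu : R) (u : R -> R) (x v : R) : Prop :=
  exists u' : R -> R, (forall y, derivable_pt_lim u y (u' y)) /\
    is_frac_int (1 - mu) u' x v.

(* squared norm gamma_n^{(a,b)} and modified tilde-gamma *)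
Definition gam (a b : R) (n : nat) : R :=
  Rpower 2 (a + b + 1) * Gamma (INR n + a + 1) * Gamma (INR n + b + 1)
  / ((2 * INR n + a + b + 1) * INR (fact n) * Gamma (INR n + a + b + 1)).
Definition gamt (N : nat) (a b : R) (n : nat) : R :=
  if Nat.eqb n N then (2 + (a + b + 1) / INR N) * gam a b N else gam a b n.

Definition conn (a b a' b' : R) (l n : nat) : R :=
  if Nat.leb l n then
    epsilon (inhabits (fun _ : nat => 0))
      (fun c : nat -> R => forall y,
         jacobi a b n y = rsum (S n) (fun k => c k * jacobi a' b' k y)) l
  else 0.

Definition lagr (N : nat) (x : nat -> R) (j : nat) (y : R) : R :=
  rprod (S N) (fun k => if Nat.eqb k j then 1 else (y - x k) / (x j - x k)).

Definition tcoef (N : nat) (a b : R) (x w : nat -> R) (n j : nat) : R :=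
  w j / gamt N a b n * jacobi a b n (x j).
Definition scoef (N : nat) (a b : R) (x w : nat -> R) (l j : nat) : R :=
  / 2 * rsum (S N) (fun n =>
    if andb (Nat.leb (l - 1) n) (Nat.leb 1 n) then
      (INR n + a + b + 1) * conn (a + 1) (b + 1) 0 0 (l - 1) (n - 1)
        * tcoef N a b x w n j
    else 0).

Definition Dformula (N : nat) (a b mu : R) (x w : nat -> R) (j : nat) (y : R) : R :=
  powr (1 + y) (1 - mu) *
  rsum (S N) (fun l => if Nat.eqb l 0 then 0 else
    INR (fact (l - 1)) / Gamma (INR l + 1 - mu) * scoef N a b x w l j
      * jacobi (mu - 1) (1 - mu) (l - 1) y).

Definition kron (i j : nat) : R := if Nat.eqb i j then 1 else 0.

(* Main.v *)
(** In the variable s = (1 - y) / 2 the Jacobi polynomials are eigenvectors of the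
    hypergeometric operator, which is symmetric for the moment functional of the weight
    (1 - y)^a (1 + y)^b.  Hence they are orthogonal, and differentiation, which maps
    P_n^(a,b) to a multiple of P_(n-1)^(a+1,b+1), yields their norms from the Beta integral.
    The Gauss-Lobatto rule reproduces these inner products except for <P_N, P_N>: there the
    quadrature error is read off from (1 - y^2) P_N'^2, which has degree 2N and vanishes at all
    nodes.  This gives the Jacobi coefficients t_nj of h_j, and then those of h_j' in the
    Legendre basis, the s_lj.  Finally the fractional integral of a Legendre polynomial is
    computed termwise on its expansion in powers of 1 + y, and the reflection
    P_n^(a,b)(-y) = (-1)^n P_n^(b,a)(y) turns the result into a Jacobi polynomial.  For
    a = b = 0, s_lj is obtained by integrating h_j' P_(l-1) by parts. *)

Require Import Defs.
From Stdlib Require Import Reals.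
From Stdlib Require Lra Lia ZArith Factorial ClassicalEpsilon.
From HB Require structures.
From mathcomp Require all_boot all_order all_algebra ring lra zify Rstruct.
From Coquelicot Require Coquelicot.
Open Scope R_scope.

(** [Gamma] is a chosen limit of Gauss's product, so its convergence, its functional equation and
    the Beta integral must all be derived from that product; this is done for positive arguments
    only. The formula [gam] is therefore out of reach at n = 0 when a + b + 1 <= 0. The obstacle is
    avoided because the mode n = 0 of h_j is a constant, which disappears in h_j'. The algebra never
    meets an integral: it works over any ordered field with a linear functional given by its
    moments, and a first-order recursion on the moments takes the place of integration by parts. The
    quadrature hypothesis then serves twice. It asserts that the weighted integrals of polynomials
    exist, and it expresses them through the nodes; the Beta formula identifies the values so
    obtained with the moments of the algebraic part. *)

Module JacobiAlgebra.
Import HB.structures all_boot all_order all_algebra ring lra zify.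
Set Implicit Arguments. Unset Strict Implicit. Unset Printing Implicit Defensive.
Import Order.TTheory GRing.Theory Num.Theory.
Local Open Scope ring_scope.

(** * Jacobi polynomials *)

Section Jacobi.
Variable F : realFieldType.
Implicit Types (a b c : F) (p q : {poly F}) (n k : nat).

Definition rising a k : F := \prod_(i < k) (a + i%:R).

Lemma rising0 a : rising a 0 = 1. Proof. by rewrite /rising big_ord0. Qed.

Lemma risingSr a k : rising a k.+1 = rising a k * (a + k%:R).
Proof. by rewrite /rising big_ord_recr. Qed.

Lemma risingS a k : rising a k.+1 = a * rising (a + 1) k.
Proof.
rewrite /rising big_ord_recl /= addr0; congr (_ * _).
by apply: eq_bigr => i _; rewrite -addrA /= /bump /= add1n -natr1 [1 + _]addrC.
Qed.

Lemma rising_gt0 a k : 0 < a -> 0 < rising a k.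
Proof. by move=> a0; apply: prodr_gt0 => i _; apply: ltr_wpDr. Qed.

Lemma rising_oppn n k : (n < k)%N -> rising (- n%:R) k = 0.
Proof. by move=> nk; rewrite /rising (bigD1 (Ordinal nk)) //= addNr mul0r. Qed.

Definition jcoef a b n k :=
  rising (a + 1) n / n`!%:R *
  (rising (- n%:R) k * rising (n%:R + a + b + 1) k / (rising (a + 1) k * k`!%:R)).

Definition jac a b n : {poly F} := \poly_(k < n.+1) jcoef a b n k.

(** Beyond the degree, [rising (- n) k] contains the factor -n + n, so the closed formula is already
    0 and the identities below hold for every k without a bound. *)
Lemma coef_jac a b n k : (jac a b n)`_k = jcoef a b n k.
Proof.
rewrite coef_poly; case: ltnP => // nk.
by rewrite /jcoef rising_oppn // !mul0r mulr0.
Qed.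

Lemma factr_neq0 n : n`!%:R != 0 :> F.
Proof. by rewrite pnatr_eq0 -lt0n fact_gt0. Qed.

(** The ratio of consecutive hypergeometric terms, cleared of denominators. Against [coef_jop] it is
    the eigenvalue equation read coefficient by coefficient. *)
Lemma jcoef_rec a b n k : -1 < a ->
  k.+1%:R * (k%:R + a + 1) * jcoef a b n k.+1 =
  (k%:R - n%:R) * (k%:R + n%:R + a + b + 1) * jcoef a b n k.
Proof.
move=> a1; rewrite /jcoef !risingSr factS natrM.
have h1 : rising (a + 1) k != 0 by rewrite gt_eqF // rising_gt0 //; lra.
have h2 : a + 1 + k%:R != 0 by rewrite gt_eqF //; have := ler0n F k; lra.
have h3 := factr_neq0 n; have h4 := factr_neq0 k.
have h5 : k.+1%:R != 0 :> F by rewrite pnatr_eq0.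
rewrite -natr1 addrC in h5.
by field; rewrite h1 h2 h3 h4 h5.
Qed.

(** Gauss's hypergeometric operator with upper parameters -n and n + a + b + 1 and lower parameter a
    + 1. The upper ones enter only through their sum, so the operator is the same for all n, which
    survives only in the eigenvalue. *)
Definition jop a b p : {poly F} :=
  'X * (1 - 'X) * p^`()^`() + ((a + 1)%:P - (a + b + 2)%:P * 'X) * p^`().

Lemma coef_jop a b p k : (jop a b p)`_k =
  k.+1%:R * (k%:R + a + 1) * p`_k.+1 - k%:R * (k%:R + a + b + 1) * p`_k.
Proof.
have -> : jop a b p = 'X * p^`()^`() - 'X * ('X * p^`()^`()) + (a + 1)%:P * p^`()
   - (a + b + 2)%:P * ('X * p^`()) by rewrite /jop; ring.
have XD q i : ('X * q^`())`_i = i%:R * q`_i.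
  by rewrite coefXM coef_deriv; case: i => [|i]; rewrite ?mul0r //= mulr_natl.
have XXD : ('X * ('X * p^`()^`()))`_k = k%:R * (k%:R - 1) * p`_k.
  rewrite coefXM XD coef_deriv; case: k => [|k]; first by rewrite !mul0r.
  by rewrite succnK -mulr_natr -natr1; ring.
rewrite !(coefB, coefD) XXD !coefCM !XD coef_deriv -[_ *+ k.+1]mulr_natr -natr1; ring.
Qed.

Definition jeig a b n : F := n%:R * (n%:R + a + b + 1).

Lemma jop_jac a b n : -1 < a -> jop a b (jac a b n) = - jeig a b n *: jac a b n.
Proof.
move=> a1; apply/polyP => k; rewrite coef_jop coefZ !coef_jac jcoef_rec // /jeig; ring.
Qed.

(** Each coefficient determines the next, because (k + 1)(k + a + 1) vanishes for no k when a > -1;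
    an eigenvector is thus fixed by its constant term. *)
Lemma jop_eig_unique a b c p q : -1 < a -> jop a b p = c *: p -> jop a b q = c *: q ->
  p`_0 = q`_0 -> p = q.
Proof.
move=> a1 hp hq h0; apply/polyP; elim=> [//|k IH].
have h2 : k.+1%:R * (k%:R + a + 1) != 0.
  rewrite mulf_neq0 ?pnatr_eq0 // gt_eqF //; have := ler0n F k; lra.
apply: (mulfI h2).
have := congr1 (fun r : {poly F} => r`_k) hp; have := congr1 (fun r : {poly F} => r`_k) hq.
by rewrite !coef_jop !coefZ IH => <- /addIr ->.
Qed.

(** The derivative is taken in s = (1 - y) / 2, so the usual factor (n + a + b + 2) / 2 appears
    multiplied by -2. *)
Lemma deriv_jac a b n : -1 < a ->
  (jac a b n.+1)^`() = - (n%:R + a + b + 2) *: jac (a + 1) (b + 1) n.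
Proof.
move=> a1; apply/polyP => k; rewrite coef_deriv coefZ !coef_jac /jcoef -mulr_natr.
rewrite !factS !natrM ![rising _ _.+1]risingS.
have h1 : rising (a + 1 + 1) k != 0 by rewrite gt_eqF // rising_gt0 //; lra.
have h2 : a + 1 != 0 by rewrite gt_eqF //; lra.
have h3 := factr_neq0 n; have h4 := factr_neq0 k.
have h5 : k.+1%:R != 0 :> F by rewrite pnatr_eq0.
have h6 : n.+1%:R != 0 :> F by rewrite pnatr_eq0.
rewrite -!natr1 in h5 h6 *.
have -> : - (n%:R + 1) + 1 = - n%:R :> F by ring.
have -> : n%:R + 1 + a + b + 1 + 1 = n%:R + (a + 1) + (b + 1) + 1 by ring.
by field; rewrite ?h1 ?h2 ?h3 ?h4 ?[1 + _]addrC ?h5 ?h6.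
Qed.

(** As (-n)_n = (-1)^n n!, the factor (a + 1)_n cancels. What remains depends on a and b only
    through a + b, which [jac_reflect] exploits. *)
Lemma lead_jcoef a b n : -1 < a ->
  jcoef a b n n = (-1) ^+ n * rising (n%:R + a + b + 1) n / n`!%:R.
Proof.
move=> a1.
have rN : rising (- n%:R) n = (-1) ^+ n * n`!%:R.
  elim: n => [|n IH]; first by rewrite rising0 expr0 mulr1.
  rewrite risingS -natr1 opprD addrNK IH factS natrM exprS -natr1; ring.
rewrite /jcoef rN.
have h1 : rising (a + 1) n != 0 by rewrite gt_eqF // rising_gt0 //; lra.
have h3 := factr_neq0 n.
by field; rewrite h1 h3.
Qed.

Lemma jcoef_neq0 a b n : -1 < a -> -1 < b -> jcoef a b n n != 0.
Proof.
move=> a1 b1; rewrite lead_jcoef //.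
rewrite !mulf_neq0 ?invr_eq0 ?factr_neq0 ?signr_eq0 //.
(* At n = 0 the product is empty while a + b + 1 may be negative; from n = 1 on the first factor is
   positive. *)
case: n => [|n]; first by rewrite rising0 oner_neq0.
by rewrite gt_eqF // rising_gt0 // -natr1; have := ler0n F n; lra.
Qed.

Lemma size_jac a b n : -1 < a -> -1 < b -> size (jac a b n) = n.+1.
Proof. by move=> a1 b1; rewrite size_poly_eq // jcoef_neq0. Qed.

Lemma jac0 a b : jac a b 0 = 1.
Proof.
apply/polyP => k; rewrite coef_jac coef1 /jcoef; case: k => [|k].
  by rewrite !rising0 fact0 !mulr1 invr1 !mulr1.
have -> : rising (- 0%:R) k.+1 = 0 :> F by rewrite rising_oppn.
by rewrite !mul0r mulr0.
Qed.

Lemma jop_comp a b p : jop a b (p \Po (1 - 'X)) = (jop b a p) \Po (1 - 'X).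
Proof.
rewrite /jop !(deriv_comp, derivM, derivB, derivX, derivC, derivE,
  comp_polyB, comp_polyD, comp_polyM, comp_polyX, comp_polyC).
rewrite !polyCD; ring.
Qed.

(** Swapping s and 1 - s exchanges a and b in the operator and keeps the eigenvalue, so both sides
    are proportional. The factor is read off from the leading coefficients; the constant terms would
    require the value of a Jacobi polynomial at s = 1. *)
Lemma jac_reflect a b n : -1 < a -> -1 < b ->
  jac b a n \Po (1 - 'X) = (-1) ^+ n *: jac a b n.
Proof.
move=> a1 b1; set p := _ \Po _.
have n0 : jcoef a b n 0 != 0.
  rewrite /jcoef !rising0 fact0 !mulr1 divr1 mulr1.
  by rewrite mulf_neq0 ?invr_eq0 ?factr_neq0 // gt_eqF // rising_gt0 //; lra.
pose c := p`_0 / jcoef a b n 0.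
have E : p = c *: jac a b n.
  apply: (@jop_eig_unique a b (- jeig a b n)) => //.
  - rewrite /p jop_comp jop_jac // comp_polyZ; congr (_ *: _).
    by rewrite /jeig; congr (- _); ring.
  - have -> : jop a b (c *: jac a b n) = c *: jop a b (jac a b n).
      rewrite /jop !derivZ -!scalerAr scalerDr; congr (_ + _).
    by rewrite jop_jac // !scalerA mulrC.
  - by rewrite coefZ coef_jac /c divfK.
have sp : size (1 - 'X : {poly F}) = 2.
  by rewrite -opprB size_polyN -polyC1 size_XsubC.
have L : p`_n = (-1) ^+ n * jcoef b a n n.
  have := @lead_coef_comp _ (jac b a n) (1 - 'X); rewrite sp => /(_ isT).
  rewrite /lead_coef size_comp_poly2 // sp size_jac //= coef_jac => ->.
  by rewrite coefB coef1 coefX /= sub0r mulrC.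
rewrite E in L *; move: L; rewrite coefZ coef_jac => L; congr (_ *: _).
apply: (mulIf (jcoef_neq0 n a1 b1)); rewrite L !lead_jcoef //.
by have -> : n%:R + b + a + 1 = n%:R + a + b + 1 by ring.
Qed.

End Jacobi.

(** * Moments and quadrature *)

Section Moments.
Variable F : realFieldType.
Implicit Types (a b c : F) (p q f : {poly F}) (n k : nat) (M : nat -> F).

Definition mom M p : F := \sum_(k < size p) p`_k * M k.

Lemma mom_bound M n p : (size p <= n)%N -> mom M p = \sum_(k < n) p`_k * M k.
Proof.
move=> h; rewrite /mom (big_ord_widen _ (fun k => p`_k * M k) h) [LHS]big_mkcond.
by apply: eq_bigr => k _; case: ltnP => // /(nth_default 0) ->; rewrite mul0r.
Qed.

Lemma mom_is_linear M : scalar (mom M).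
Proof.
move=> c p q; pose n := maxn (size p) (size q).
have hp : (size p <= n)%N by rewrite leq_maxl.
have hq : (size q <= n)%N by rewrite leq_maxr.
have hs : (size (c *: p + q)%R <= n)%N.
  apply: leq_trans (size_polyD _ _) _; rewrite geq_max hq andbT.
  exact: leq_trans (size_scale_leq _ _) hp.
rewrite (mom_bound _ hp) (mom_bound _ hq) (mom_bound _ hs) big_distrr -big_split /=.
by apply: eq_bigr => k _; rewrite coefD coefZ mulrDl mulrA.
Qed.
HB.instance Definition _ M := GRing.isLinear.Build F {poly F} F _ (mom M) (@mom_is_linear M).

Lemma momXn M k : mom M 'X^k = M k.
Proof.
rewrite /mom size_polyXn big_ord_recr /= coefXn eqxx mul1r big1 ?add0r // => i _.
by rewrite coefXn ltn_eqF // mul0r.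
Qed.

Lemma momXM M p : mom M ('X * p) = mom (fun k => M k.+1) p.
Proof.
have h : (size ('X * p)%R <= (size p).+1)%N.
  by have := size_polyMleq 'X p; rewrite size_polyX.
rewrite (mom_bound _ h) big_ord_recl coefXM /= mul0r add0r.
by apply: eq_bigr => k _; rewrite coefXM.
Qed.

(* Recursion for the moments of [s^a (1 - s)^b] on [0, 1]. *)
Definition pearson a b M := forall k, (k%:R + a + b + 2) * M k.+1 = (k%:R + a + 1) * M k.

(** The argument is the derivative of s^(a+1) (1-s)^(b+1) f divided by the weight s^a (1-s)^b: an
    exact derivative with vanishing boundary terms. For monomials f this is the moment recursion
    itself. *)
Lemma mom_pearson a b M f : pearson a b M ->
  mom M ('X * (1 - 'X) * f^`() + ((a + 1)%:P - (a + b + 2)%:P * 'X) * f) = 0.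
Proof.
move=> hM.
have -> : 'X * (1 - 'X) * f^`() + ((a + 1)%:P - (a + b + 2)%:P * 'X) * f =
  ('X * f^`() + (a + 1) *: f) - 'X * ('X * f^`() + (a + b + 2) *: f).
  by rewrite -!mul_polyC; ring.
rewrite linearB /= momXM.
have h c : (size ('X * f^`() + c *: f)%R <= size f)%N.
  apply: leq_trans (size_polyD _ _) _; rewrite geq_max size_scale_leq andbT.
  have [->|f0] := eqVneq f 0; first by rewrite deriv0 mulr0.
  have := size_polyMleq 'X f^`(); rewrite size_polyX => /leq_trans; apply.
  by rewrite /= -[size f](ltn_predK (lt_size_deriv f0)) ltnS -ltnS
    (ltn_predK (lt_size_deriv f0)) lt_size_deriv.
rewrite !(mom_bound _ (h _)) -sumrB big1 // => k _.
have E c : ('X * f^`() + c *: f)`_k = (k%:R + c) * f`_k.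
  rewrite coefD coefXM coefZ coef_deriv; case: (nat_of_ord k) => [|m] /=; first by rewrite !add0r.
  by rewrite -mulr_natr; ring.
rewrite !E.
have -> : (k%:R + (a + 1)) * f`_k * M k = f`_k * ((k%:R + a + 1) * M k) by ring.
rewrite -hM; ring.
Qed.

(** Take f = p' q in [mom_pearson]: the terms without q' make up the operator applied to p, times q,
    and the one with q' is the left side. *)
Lemma mom_jop a b M p q : pearson a b M ->
  mom M ('X * (1 - 'X) * (p^`() * q^`())) = - mom M (jop a b p * q).
Proof.
move=> hM; apply/eqP; rewrite -subr_eq0 opprK -linearD /=; apply/eqP.
rewrite -(mom_pearson (p^`() * q) hM); congr mom.
by rewrite /jop derivM; ring.
Qed.

Lemma mom_jac_deriv a b M n q : -1 < a -> pearson a b M ->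
  mom M ('X * (1 - 'X) * ((jac a b n)^`() * q^`())) = jeig a b n * mom M (jac a b n * q).
Proof.
move=> a1 hM; rewrite (mom_jop _ _ hM) jop_jac // -scalerAl linearZ /=; ring.
Qed.

Lemma jac_orth a b M n m : -1 < a -> -1 < b -> pearson a b M -> n != m ->
  mom M (jac a b n * jac a b m) = 0.
Proof.
move=> a1 b1 hM nm.
have h : jeig a b n * mom M (jac a b n * jac a b m) = jeig a b m * mom M (jac a b n * jac a b m).
  rewrite -mom_jac_deriv // [jac a b n * jac _ _ _]mulrC -mom_jac_deriv //.
  by rewrite [_^`() * _^`()]mulrC.
apply/eqP; have /eqP := h; rewrite -subr_eq0 -mulrBl mulf_eq0 => /orP[|//].
(* The second factor of this eigenvalue gap is positive: n <> m forces n + m >= 1, and a + b >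
   -2. *)
have -> : jeig a b n - jeig a b m = (n%:R - m%:R) * ((n + m)%:R + a + b + 1).
  by rewrite /jeig natrD; ring.
rewrite mulf_eq0 subr_eq0 eqr_nat (negPf nm) /=.
have : 1 <= (n + m)%:R :> F by rewrite ler1n; lia.
by move=> h1 /eqP; lra.
Qed.

(** The moments of the weight multiplied by s (1 - s), that is, of the weight with both exponents
    raised by one. *)
Definition shiftM M k := M k.+1 - M k.+2.

Lemma mom_shift M p : mom M ('X * (1 - 'X) * p) = mom (shiftM M) p.
Proof.
rewrite -mulrA mulrBl mul1r momXM linearB /= momXM /mom -sumrB.
by apply: eq_bigr => k _; rewrite /shiftM mulrBr.
Qed.

Lemma pearson_pos a b k : -1 < a -> -1 < b -> 0 < k%:R + a + b + 2.
Proof. by move=> a1 b1; have := ler0n F k; lra. Qed.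

Lemma pearson_shift a b M : -1 < a -> -1 < b -> pearson a b M -> pearson (a + 1) (b + 1) (shiftM M).
Proof.
move=> a1 b1 hM k; rewrite /shiftM.
have E k' : M k'.+1 = (k'%:R + a + 1) / (k'%:R + a + b + 2) * M k'.
  apply: (mulfI (lt0r_neq0 (pearson_pos k' a1 b1))); rewrite hM; field.
  exact: lt0r_neq0 (pearson_pos k' a1 b1).
rewrite !E -!natr1; field.
have h0 := pearson_pos k a1 b1; have hk := ler0n F k.
by apply/and3P; split; apply: lt0r_neq0; lra.
Qed.

(* Squared norm of the Jacobi polynomial relative to the total mass. *)
Fixpoint jnorm a b n : F := if n is m.+1 then
  (m%:R + a + b + 2) / m.+1%:R * ((a + 1) * (b + 1) / ((a + b + 2) * (a + b + 3)))
  * jnorm (a + 1) (b + 1) m else 1.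

Lemma jnorm_gt0 a b n : -1 < a -> -1 < b -> 0 < jnorm a b n.
Proof.
elim: n a b => [|n IH] a b a1 b1 /=; first exact: ltr01.
have := ler0n F n => hn.
by rewrite !(mulr_gt0, divr_gt0, ltr0Sn, IH) ?invr_gt0 ?mulr_gt0 //; lra.
Qed.

(** The eigenvalue turns the norm of P_(n+1) into the pairing of its derivative with itself under
    the weight times s (1 - s). By [deriv_jac] this is a norm of index n for a + 1, b + 1 and the
    shifted moments, whose mass M 1 - M 2 supplies the last fraction in [jnorm]. *)
Lemma jac_norm a b M n : -1 < a -> -1 < b -> pearson a b M ->
  mom M (jac a b n * jac a b n) = M 0 * jnorm a b n.
Proof.
elim: n a b M => [|n IH] a b M a1 b1 hM.
  by rewrite jac0 mulr1 /= mulr1 -(momXn M 0).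
have e0 : jeig a b n.+1 != 0.
  rewrite /jeig mulf_neq0 ?pnatr_eq0 //; apply: lt0r_neq0; rewrite -natr1.
  have := ler0n F n; lra.
apply: (mulfI e0); rewrite -mom_jac_deriv // deriv_jac // -scalerAl -!scalerAr !linearZ /=.
rewrite mom_shift IH; [|lra|lra|exact: pearson_shift].
rewrite /shiftM /jeig.
have E k' : M k'.+1 = (k'%:R + a + 1) / (k'%:R + a + b + 2) * M k'.
  apply: (mulfI (lt0r_neq0 (pearson_pos k' a1 b1))); rewrite hM; field.
  exact: lt0r_neq0 (pearson_pos k' a1 b1).
rewrite !E -!natr1; have hn := ler0n F n; field.
by apply/and3P; split; apply: lt0r_neq0; lra.
Qed.

Lemma poly_basis (q : nat -> {poly F}) n p : (forall k, size (q k) = k.+1) ->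
  (size p <= n)%N -> exists c : nat -> F, p = \sum_(k < n) c k *: q k.
Proof.
move=> hq; elim: n p => [|n IH] p.
  by rewrite leqn0 size_poly_eq0 => /eqP ->; exists (fun=> 0); rewrite big_ord0.
move=> hp; pose d := p`_n / (q n)`_n.
have qn0 : (q n)`_n != 0.
  have := lead_coef_eq0 (q n); rewrite /lead_coef hq /= => ->.
  by rewrite -size_poly_eq0 hq.
have [|c E] := IH (p - d *: q n).
  apply/leq_sizeP => i; rewrite leq_eqVlt coefB coefZ => /orP[/eqP <-|ni].
    by rewrite /d divfK // subrr.
  by rewrite !nth_default ?mulr0 ?subr0 ?hq //; apply: leq_trans ni.
exists (fun k => if k == n then d else c k); rewrite big_ord_recr /= eqxx.
rewrite -[LHS](subrK (d *: q n)) E; congr (_ + _); apply: eq_bigr => k _.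
by rewrite ltn_eqF.
Qed.

(** * The Gauss-Lobatto rule and discrete orthogonality *)

Section Quadrature.
Variables (N : nat) (a b : F) (M : nat -> F) (s w : nat -> F).
Hypotheses (N0 : (0 < N)%N) (a1 : -1 < a) (b1 : -1 < b) (hM : pearson a b M).
Hypothesis nodes : forall j, (j <= N)%N -> s j * (1 - s j) * (jac a b N)^`().[s j] = 0.

Definition quad p := \sum_(j < N.+1) p.[s j] * w j.

Hypothesis exact : forall k, (k < 2 * N)%N -> quad 'X^k = M k.

Lemma quad_is_linear : scalar quad.
Proof.
move=> c p q; rewrite /quad big_distrr -big_split /=; apply: eq_bigr => j _.
by rewrite hornerD hornerZ mulrDl mulrA.
Qed.
HB.instance Definition _ := GRing.isLinear.Build F {poly F} F _ quad quad_is_linear.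

Lemma quad_exact p : (size p <= 2 * N)%N -> quad p = mom M p.
Proof.
move=> h; rewrite -(coefK p) poly_def !linear_sum; apply: eq_bigr => k _.
by rewrite !linearZ /= momXn exact // (leq_trans (ltn_ord k)).
Qed.

Lemma quad_jac n m : (n + m < 2 * N)%N ->
  quad (jac a b n * jac a b m) = mom M (jac a b n * jac a b m).
Proof.
move=> h; apply: quad_exact; apply: leq_trans (size_polyMleq _ _) _.
by rewrite !size_jac //; lia.
Qed.

(* The error [mom M - quad] on degree [2N] only sees the leading coefficient,
   and is known on ['X (1 - 'X) P_N'^2], which vanishes at the nodes. *)
Lemma quad_jacN : quad (jac a b N * jac a b N) =
  (2 + (a + b + 1) / N%:R) * mom M (jac a b N * jac a b N).
Proof.
set P := jac a b N; set D := 'X * (1 - 'X) * (P^`() * P^`()).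
have hN : N%:R != 0 :> F by rewrite pnatr_eq0 -lt0n.
have sP : size P = N.+1 by rewrite size_jac.
have qD : quad D = 0.
  rewrite /quad big1 // => j _; rewrite !hornerM hornerD hornerN hornerX -polyC1 hornerC.
  by have := nodes (leq_ord j); rewrite -/P => h; rewrite mulrA h !mul0r.
have mD : mom M D = jeig a b N * mom M (P * P) by rewrite mom_jac_deriv.
(* The leading coefficient of s (1 - s) is -1 and that of P' is N times that of P, so N^2 P^2
   cancels the top coefficient of D. Exactness on E then yields the factor 1 + (N + a + b + 1) /
   N. *)
pose E := D + N%:R ^+ 2 *: (P * P).
have sE : (size E <= 2 * N)%N.
  have sX : size ('X * (1 - 'X) : {poly F}) = 3%N.
    rewrite size_proper_mul; rewrite -opprB -polyC1 ?lead_coefN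
      ?lead_coefX ?lead_coefXsubC ?size_polyN ?size_XsubC ?size_polyX //.
    by rewrite mul1r oppr_eq0 oner_neq0.
  have lX : lead_coef ('X * (1 - 'X) : {poly F}) = -1.
    by rewrite lead_coefM -opprB -polyC1 lead_coefN lead_coefX lead_coefXsubC mul1r.
  have P'N : P^`()`_N.-1 = N%:R * P`_N.
    by rewrite coef_deriv prednK // mulr_natl.
  have PN : P`_N != 0.
    have := lead_coef_eq0 P; rewrite /lead_coef sP /= => ->.
    by rewrite -size_poly_eq0 sP.
  have sP' : size P^`() = N.
    apply/eqP; rewrite eqn_leq; apply/andP; split.
      have := lt_size_deriv (p := P); rewrite sP ltnS; apply.
      by rewrite -size_poly_eq0 sP.
    rewrite leqNgt; apply/negP => h.
    have : P^`()`_N.-1 = 0 by rewrite nth_default // -ltnS prednK.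
    by move/eqP; rewrite P'N mulf_eq0 (negPf hN) (negPf PN).
  have lP' : lead_coef P^`() = N%:R * P`_N by rewrite /lead_coef sP' P'N.
  have P'0 : P^`() != 0 by rewrite -size_poly_eq0 sP' -lt0n.
  have P0 : P != 0 by rewrite -size_poly_eq0 sP.
  have X0 : 'X * (1 - 'X) != 0 :> {poly F} by rewrite -size_poly_eq0 sX.
  have sD : size D = (2 * N).+1.
    by rewrite (size_mul X0 (mulf_neq0 P'0 P'0)) sX (size_mul P'0 P'0) sP'; lia.
  have sPP : size (P * P)%R = (2 * N).+1 by rewrite size_mul // sP; lia.
  have lD : D`_(2 * N) = - (N%:R * P`_N) ^+ 2.
    have := lead_coefM ('X * (1 - 'X)) (P^`() * P^`()).
    rewrite -/D lX [lead_coef (P^`() * _)]lead_coefM lP' /lead_coef sD /= => ->; ring.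
  have lPP : (P * P)`_(2 * N) = P`_N ^+ 2.
    have := lead_coefM P P; rewrite /lead_coef sPP sP /= => ->; ring.
  apply/leq_sizeP => i; rewrite leq_eqVlt coefD coefZ => /orP[/eqP <-|ni].
    rewrite lD lPP; ring.
  by rewrite !nth_default ?mulr0 ?addr0 ?sD ?sPP.
have := quad_exact sE; rewrite /E !linearD !linearZ /= qD mD add0r => h.
have h2 : N%:R ^+ 2 != 0 :> F by rewrite expf_neq0.
apply: (mulfI h2); rewrite h /jeig; field.
by [].
Qed.

Definition jnormt n := (if n == N then 2 + (a + b + 1) / N%:R else 1) * (M 0 * jnorm a b n).

Lemma quad_jac_orth n m : (n <= N)%N -> (m <= N)%N ->
  quad (jac a b n * jac a b m) = if n == m then jnormt n else 0.
Proof.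
move=> hn hm; rewrite /jnormt; case: eqVneq => [<-|nm].
  case: eqVneq => [->|nN]; first by rewrite quad_jacN jac_norm.
  by rewrite quad_jac ?jac_norm ?mul1r //; lia.
by rewrite quad_jac ?jac_orth //; lia.
Qed.

(** Pair H with P_n by the quadrature: the nodal values of H leave the single term of node j, and
    discrete orthogonality isolates c n in the expansion. *)
Lemma lagrange_jac_coef (H : {poly F}) j : (j <= N)%N -> (size H <= N.+1)%N ->
  (forall i, (i <= N)%N -> H.[s i] = (i == j)%:R) ->
  exists c : nat -> F, H = \sum_(n < N.+1) c n *: jac a b n /\
    forall n, (n <= N)%N -> c n * jnormt n = w j * (jac a b n).[s j].
Proof.
move=> hj sH hH; have [c E] := poly_basis (fun k => size_jac k a1 b1) sH.
exists c; split=> // n hn.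
have : quad (H * jac a b n) = w j * (jac a b n).[s j].
  rewrite /quad (bigD1 (inord j)) //= inordK // hornerM hH // eqxx mul1r mulrC.
  rewrite big1 ?addr0 // => i ij; rewrite hornerM hH ?leq_ord //.
  case: eqP => [e|]; last by rewrite !mul0r.
  by case/eqP: ij; apply: val_inj; rewrite /= inordK.
move=> <-; rewrite E mulr_suml linear_sum (bigD1 (inord n)) //= inordK //.
rewrite -scalerAl linearZ /= quad_jac_orth // eqxx big1 ?addr0 // => i ij.
rewrite -scalerAl linearZ /= quad_jac_orth ?leq_ord // ifF ?mulr0 //.
by apply/eqP => e; case/eqP: ij; apply: val_inj; rewrite /= inordK.
Qed.

End Quadrature.
End Moments.

End JacobiAlgebra.

Module BetaGamma.
Import Lra Lia ZArith Factorial ClassicalEpsilon Coquelicot.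

(** * Finite products, rising factorials and elementary inequalities *)

Lemma rprod_ext n f g : (forall k, (k < n)%nat -> f k = g k) -> rprod n f = rprod n g.
Proof.
  induction n as [|n IH]; intros H; simpl; [reflexivity|].
  rewrite IH, H; auto.
Qed.

Lemma rprod_recl n f : rprod (S n) f = f O * rprod n (fun k => f (S k)).
Proof.
  induction n as [|n IH]; [simpl; ring|].
  change (rprod (S (S n)) f) with (rprod (S n) f * f (S n)).
  rewrite IH; simpl; ring.
Qed.

Lemma pochS a n : poch a (S n) = poch a n * (a + INR n).
Proof. reflexivity. Qed.

Lemma pochSl a n : poch a (S n) = a * poch (a + 1) n.
Proof.
  unfold poch; rewrite rprod_recl; simpl (INR 0); rewrite Rplus_0_r; f_equal.
  apply rprod_ext; intros k _; rewrite S_INR; ring.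
Qed.

Lemma poch_pos a n : 0 < a -> 0 < poch a n.
Proof.
  intros Ha; induction n as [|n IH]; [unfold poch; simpl; lra|].
  rewrite pochS; apply Rmult_lt_0_compat; [exact IH|].
  pose proof (pos_INR n); lra.
Qed.

Lemma poch_1 n : poch 1 n = INR (fact n).
Proof.
  induction n as [|n IH]; [reflexivity|].
  rewrite pochS, IH, fact_simpl, mult_INR, S_INR; ring.
Qed.

Lemma exp_le_compat x y : x <= y -> exp x <= exp y.
Proof.
  intros [H|H]; [left; apply exp_increasing, H | right; f_equal; exact H].
Qed.

Lemma ln_le_sub1 x : 0 < x -> ln x <= x - 1.
Proof.
  intros Hx; pose proof (exp_ineq1_le (ln x)) as H.
  rewrite exp_ln in H; lra.
Qed.

Lemma is_lim_seq_ratio (p q : R) : is_lim_seq (fun n => (INR n + p) / (INR n + q)) 1.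
Proof.
  assert (Hq : is_lim_seq (fun n => INR n + q) p_infty).
  { apply (is_lim_seq_plus _ _ p_infty q p_infty);
      [apply is_lim_seq_INR | apply is_lim_seq_const | reflexivity]. }
  assert (Hi : is_lim_seq (fun n => / (INR n + q)) 0).
  { apply (is_lim_seq_inv _ p_infty); [exact Hq | discriminate]. }
  assert (H1 : is_lim_seq (fun n => 1 + (p - q) * / (INR n + q)) 1).
  { replace (Finite 1) with (Finite (1 + (p - q) * 0)) by (f_equal; ring).
    apply is_lim_seq_plus'; [apply is_lim_seq_const|].
    apply (is_lim_seq_scal_l _ (p - q) 0 Hi). }
  apply is_lim_seq_ext_loc with (2 := H1).
  apply is_lim_seq_spec in Hq; destruct (Hq 0) as [n0 Hn0].
  exists n0; intros n Hn; specialize (Hn0 n Hn); field; lra.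
Qed.

(** * The Gamma function *)

Definition gseq (z : R) (n : nat) : R :=
  INR (fact n) * Rpower (INR n) z / poch z (S n).

Lemma gseq_pos z n : 0 < z -> 0 < gseq z n.
Proof.
  intros Hz; unfold gseq; apply Rdiv_lt_0_compat; [|apply poch_pos, Hz].
  apply Rmult_lt_0_compat; [apply INR_fact_lt_0 | apply exp_pos].
Qed.

Lemma gseqS z n : 0 < z -> (1 <= n)%nat ->
  gseq z (S n) = gseq z n * (Rpower (1 + / INR n) z * (INR n + 1) / (z + INR n + 1)).
Proof.
  intros Hz Hn.
  assert (Hn' : 0 < INR n) by (apply lt_0_INR; lia).
  unfold gseq; rewrite (pochS z (S n)), fact_simpl, mult_INR, S_INR.
  replace (INR n + 1) with (INR n * (1 + / INR n)) at 2 by (field; lra).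
  rewrite <- Rpower_mult_distr; [|lra|pose proof (Rinv_0_lt_compat _ Hn'); lra].
  pose proof (poch_pos z (S n) Hz); field; repeat split; lra.
Qed.

(** The quotient of consecutive terms is at least 1 because (1 + 1/n)^z >= 1 + z ln (1 + 1/n) >= 1 +
    z / (n + 1). *)
Lemma gseq_growing z n : 0 < z -> (1 <= n)%nat -> gseq z n <= gseq z (S n).
Proof.
  intros Hz Hn.
  assert (Hn' : 0 < INR n) by (apply lt_0_INR; lia).
  rewrite gseqS by assumption.
  rewrite <- (Rmult_1_r (gseq z n)) at 1.
  apply Rmult_le_compat_l; [left; apply gseq_pos, Hz|].
  apply Rmult_le_reg_r with (z + INR n + 1); [lra|].
  unfold Rdiv; rewrite Rmult_assoc, Rinv_l, Rmult_1_r, Rmult_1_l by lra.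
  pose proof (Rinv_0_lt_compat _ Hn') as Hi.
  assert (Hl : / (INR n + 1) <= ln (1 + / INR n)).
  { pose proof (ln_le_sub1 (/ (1 + / INR n))) as H.
    rewrite ln_Rinv in H by lra.
    assert (0 < / (1 + / INR n)) by (apply Rinv_0_lt_compat; lra).
    replace (/ (INR n + 1)) with (1 - / (1 + / INR n)) by (field; lra).
    lra. }
  pose proof (exp_ineq1_le (z * ln (1 + / INR n))) as He.
  change (exp (z * ln (1 + / INR n))) with (Rpower (1 + / INR n) z) in He.
  assert (z * / (INR n + 1) <= z * ln (1 + / INR n)) by (apply Rmult_le_compat_l; lra).
  replace (z + INR n + 1) with ((1 + z * / (INR n + 1)) * (INR n + 1)) by (field; lra).
  apply Rmult_le_compat_r; lra.
Qed.

(** Concavity of ln: the tangent bound at 1 + z t, which is the mean of 1 + t and 1 with weights z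
    and 1 - z, is applied to these two numbers. *)
Lemma Rpower_bernoulli t z : 0 < t -> 0 <= z <= 1 -> Rpower (1 + t) z <= 1 + z * t.
Proof.
  intros Ht Hz.
  assert (Hm : 0 < 1 + z * t) by nra.
  rewrite <- (exp_ln (1 + z * t)) by exact Hm.
  unfold Rpower; apply exp_le_compat.
  pose proof (Rinv_0_lt_compat _ Hm) as Hi.
  pose proof (ln_le_sub1 ((1 + t) * / (1 + z * t)) ltac:(nra)) as H1.
  pose proof (ln_le_sub1 (/ (1 + z * t)) Hi) as H2.
  rewrite ln_mult, ln_Rinv in H1 by lra.
  rewrite ln_Rinv in H2 by lra.
  assert (H3 : z * ((1 + t) * / (1 + z * t) - 1) + (1 - z) * (/ (1 + z * t) - 1) = 0)
    by (field; lra).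
  nra.
Qed.

Lemma gseq_bounded z n : 0 < z <= 1 -> gseq z (S n) <= gseq z 1 * (1 + z).
Proof.
  intros Hz.
  (* With the factor (n + z) / n the sequence decreases: its quotient reduces to (1 + 1/n)^z against
     1 + z/n, where z <= 1 enters. *)
  assert (H : gseq z (S n) * ((INR (S n) + z) / INR (S n)) <= gseq z 1 * (1 + z)).
  { induction n as [|n IH]; [simpl (INR 1); right; field|].
    apply Rle_trans with (2 := IH).
    rewrite (gseqS z (S n)) by (lra || lia).
    rewrite Rmult_assoc; apply Rmult_le_compat_l; [left; apply gseq_pos; lra|].
    rewrite (S_INR (S n)).
    set (m := INR (S n)); assert (Hm : 0 < m) by (apply lt_0_INR; lia).
    pose proof (Rpower_bernoulli (/ m) z (Rinv_0_lt_compat _ Hm) ltac:(lra)) as HB.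
    replace ((m + z) / m) with (1 + z * / m) by (field; lra).
    replace (Rpower (1 + / m) z * (m + 1) / (z + m + 1) * ((m + 1 + z) / (m + 1)))
      with (Rpower (1 + / m) z) by (field; lra).
    exact HB. }
  assert (Hn : 0 < INR (S n)) by (apply lt_0_INR; lia).
  apply Rle_trans with (2 := H).
  rewrite <- (Rmult_1_r (gseq z (S n))) at 1.
  apply Rmult_le_compat_l; [left; apply gseq_pos; lra|].
  apply Rmult_le_reg_r with (INR (S n)); [lra|].
  unfold Rdiv; rewrite Rmult_assoc, Rinv_l by lra; lra.
Qed.

(** The functional equation before the limit. The [+ 0] puts the correction factor into the form of
    [is_lim_seq_ratio]. *)
Lemma gseq_shift z n : 0 < z -> (1 <= n)%nat ->
  gseq (z + 1) n = z * gseq z n * ((INR n + 0) / (INR n + (z + 1))).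
Proof.
  intros Hz Hn; unfold gseq.
  assert (Hn' : 0 < INR n) by (apply lt_0_INR; lia).
  assert (E : z * poch (z + 1) (S n) = poch z (S n) * (z + INR n + 1)).
  { rewrite <- pochSl, (pochS z (S n)), S_INR; ring. }
  pose proof (poch_pos z (S n) Hz); pose proof (poch_pos (z + 1) (S n) ltac:(lra)).
  replace (poch (z + 1) (S n)) with (poch z (S n) * (z + INR n + 1) / z)
    by (rewrite <- E; field; lra).
  rewrite Rpower_plus, Rpower_1 by exact Hn'.
  field; repeat split; lra.
Qed.

Lemma gseq_shift_lim (z l : R) : 0 < z -> 
  is_lim_seq (gseq z) (Finite l) -> is_lim_seq (gseq (z + 1)) (z * l).
Proof.
  intros Hz Hl.
  apply is_lim_seq_ext_loc with (fun n => z * gseq z n * ((INR n + 0) / (INR n + (z + 1)))).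
  { exists 1%nat; intros n Hn; symmetry; apply gseq_shift; assumption. }
  replace (Finite (z * l)) with (Finite (z * l * 1)) by (f_equal; ring).
  apply is_lim_seq_mult'; [|apply is_lim_seq_ratio].
  apply (is_lim_seq_scal_l _ z l Hl).
Qed.

(** For z <= 1 the sequence is increasing and bounded; larger z are reached by unit shifts, counted
    by the induction. *)
Lemma gseq_cv z : 0 < z -> exists l, 0 < l /\ is_lim_seq (gseq z) (Finite l).
Proof.
  intros Hz.
  assert (Hk : exists k, z <= INR (S k)).
  { destruct (INR_unbounded z) as [k Hk]; exists k; rewrite S_INR; lra. }
  destruct Hk as [k Hk]; revert z Hz Hk; induction k as [|k IH]; intros z Hz Hk.
  - simpl in Hk.
    destruct (ex_finite_lim_seq_incr (fun n => gseq z (S n)) (gseq z 1 * (1 + z))) as [l Hl].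
    + intros n; apply gseq_growing; [exact Hz | lia].
    + intros n; apply gseq_bounded; lra.
    + exists l; split; [|apply is_lim_seq_incr_1, Hl].
      apply Rlt_le_trans with (gseq z 1); [apply gseq_pos, Hz|].
      apply (is_lim_seq_incr_compare (fun n => gseq z (S n)) l Hl) with (n := O).
      intros n; apply gseq_growing; [exact Hz | lia].
  - destruct (Rle_lt_dec z 1) as [Hz1|Hz1].
    + apply IH; [exact Hz | rewrite S_INR; pose proof (pos_INR k); lra].
    + destruct (IH (z - 1)) as [l [Hl1 Hl2]]; [lra | rewrite S_INR in *; rewrite S_INR in *; lra|].
      exists ((z - 1) * l); split; [apply Rmult_lt_0_compat; lra|].
      replace z with (z - 1 + 1) at 1 by ring.
      apply gseq_shift_lim; [lra | exact Hl2].
Qed.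

Lemma Gamma_lim z : 0 < z -> is_lim_seq (gseq z) (Gamma z).
Proof.
  intros Hz; destruct (gseq_cv z Hz) as [l [_ Hl]].
  apply is_lim_seq_Reals; unfold Gamma, Rlim.
  apply (epsilon_spec (inhabits 0) (fun l => Un_cv (gseq z) l)).
  exists l; apply is_lim_seq_Reals, Hl.
Qed.

Lemma Gamma_pos z : 0 < z -> 0 < Gamma z.
Proof.
  intros Hz; destruct (gseq_cv z Hz) as [l [Hl0 Hl]].
  pose proof (is_lim_seq_unique _ _ Hl) as E.
  rewrite (is_lim_seq_unique _ _ (Gamma_lim z Hz)) in E.
  injection E as E; lra.
Qed.

Lemma Gamma_succ z : 0 < z -> Gamma (z + 1) = z * Gamma z.
Proof.
  intros Hz.
  pose proof (is_lim_seq_unique _ _ (gseq_shift_lim z _ Hz (Gamma_lim z Hz))) as E.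
  rewrite (is_lim_seq_unique _ _ (Gamma_lim (z + 1) ltac:(lra))) in E.
  injection E as E; exact E.
Qed.

Lemma Gamma_poch z n : 0 < z -> Gamma (z + INR n) = poch z n * Gamma z.
Proof.
  intros Hz; induction n as [|n IH].
  - unfold poch; simpl; rewrite Rplus_0_r; ring.
  - rewrite S_INR, pochS, <- Rplus_assoc, Gamma_succ, IH; [ring|].
    pose proof (pos_INR n); lra.
Qed.

(** * Improper integrals *)

(** [improper_int] with the proof object [Riemann_integrable] replaced by the relation [is_RInt], so
    that Coquelicot's calculus applies. *)
Definition impr (f : R -> R) (a b v : R) : Prop :=
  forall eps, 0 < eps -> exists delta, 0 < delta /\
    forall c d, a < c < a + delta -> b - delta < d < b -> c <= d ->
      exists I, is_RInt f c d I /\ Rabs (I - v) < eps.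

Lemma improper_intE f a b v : improper_int f a b v <-> impr f a b v.
Proof.
  split; intros H eps Heps; destruct (H eps Heps) as [delta [Hd H']];
    exists delta; split; try exact Hd; intros c d Hc Hd' Hcd;
    destruct (H' c d Hc Hd' Hcd) as [I HI].
  - exists (RiemannInt I); split; [|exact HI].
    rewrite <- RInt_Reals; apply (RInt_correct (V := R_CompleteNormedModule)), ex_RInt_Reals_1, I.
  - destruct HI as [HI1 HI2].
    assert (He : ex_RInt f c d) by (exists I; exact HI1).
    exists (ex_RInt_Reals_0 _ _ _ He).
    rewrite <- RInt_Reals, (is_RInt_unique _ _ _ _ HI1); exact HI2.
Qed.

Lemma impr_ext f g a b v : (forall y, a < y < b -> f y = g y) -> impr f a b v -> impr g a b v.
Proof.
  intros E H eps Heps; destruct (H eps Heps) as [delta [Hd H']].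
  exists delta; split; [exact Hd|]; intros c d Hc Hd' Hcd.
  destruct (H' c d Hc Hd' Hcd) as [I [HI1 HI2]]; exists I; split; [|exact HI2].
  apply is_RInt_ext with (2 := HI1); intros y Hy; apply E.
  rewrite Rmin_left, Rmax_right in Hy by lra; lra.
Qed.

Lemma impr_lin f g a b v w k l : impr f a b v -> impr g a b w ->
  impr (fun y => k * f y + l * g y) a b (k * v + l * w).
Proof.
  intros Hf Hg eps Heps.
  set (K := Rabs k + Rabs l + 1).
  assert (HK : 0 < K) by (unfold K; pose proof (Rabs_pos k); pose proof (Rabs_pos l); lra).
  assert (He : 0 < eps / K) by (apply Rdiv_lt_0_compat; lra).
  destruct (Hf _ He) as [d1 [Hd1 H1]]; destruct (Hg _ He) as [d2 [Hd2 H2]].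
  exists (Rmin d1 d2); split; [apply Rmin_glb_lt; assumption|]; intros c d Hc Hd Hcd.
  pose proof (Rmin_l d1 d2); pose proof (Rmin_r d1 d2).
  destruct (H1 c d) as [I [HI1 HI2]]; try lra.
  destruct (H2 c d) as [J [HJ1 HJ2]]; try lra.
  exists (k * I + l * J); split.
  - apply (is_RInt_plus (V := R_NormedModule));
      apply (is_RInt_scal (V := R_NormedModule)); assumption.
  - replace (k * I + l * J - (k * v + l * w)) with (k * (I - v) + l * (J - w)) by ring.
    apply Rle_lt_trans with (1 := Rabs_triang _ _); rewrite !Rabs_mult.
    apply Rle_lt_trans with ((Rabs k + Rabs l) * (eps / K)).
    + pose proof (Rabs_pos k); pose proof (Rabs_pos l); nra.
    + replace eps with (K * (eps / K)) at 2 by (field; lra).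
      apply Rmult_lt_compat_r; unfold K in *; lra.
Qed.

Lemma impr_le f g a b v w : a < b -> (forall y, a < y < b -> f y <= g y) ->
  impr f a b v -> impr g a b w -> v <= w.
Proof.
  intros Hab Hle Hf Hg; apply le_epsilon; intros eps Heps.
  destruct (Hf (eps / 2)) as [d1 [Hd1 H1]]; [lra|].
  destruct (Hg (eps / 2)) as [d2 [Hd2 H2]]; [lra|].
  set (h := Rmin (Rmin d1 d2) (b - a) / 2).
  assert (Hh : 0 < h /\ h < d1 /\ h < d2 /\ 2 * h <= b - a).
  { unfold h; pose proof (Rmin_l (Rmin d1 d2) (b - a)); pose proof (Rmin_r (Rmin d1 d2) (b - a)).
    pose proof (Rmin_l d1 d2); pose proof (Rmin_r d1 d2).
    assert (0 < Rmin (Rmin d1 d2) (b - a)) by (repeat apply Rmin_glb_lt; lra). lra. }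
  destruct (H1 (a + h) (b - h)) as [I [HI1 HI2]]; try lra.
  destruct (H2 (a + h) (b - h)) as [J [HJ1 HJ2]]; try lra.
  assert (I <= J).
  { apply (is_RInt_le f g (a + h) (b - h)); try assumption; [lra|].
    intros y Hy; apply Hle; lra. }
  apply Rabs_def2 in HI2; apply Rabs_def2 in HJ2; lra.
Qed.

(** Only limits of the primitive are asked at the two ends, where the integrand may be singular. *)
Lemma impr_FTC (F f : R -> R) a b A B : a < b ->
  (forall y, a < y < b -> is_derive F y (f y)) ->
  (forall y, a < y < b -> continuous f y) ->
  (forall eps, 0 < eps -> exists delta, 0 < delta /\
     forall y, a < y < b -> y < a + delta -> Rabs (F y - A) < eps) ->
  (forall eps, 0 < eps -> exists delta, 0 < delta /\
     forall y, a < y < b -> b - delta < y -> Rabs (F y - B) < eps) ->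
  impr f a b (B - A).
Proof.
  intros Hab HF Hf HA HB eps Heps.
  destruct (HA (eps / 2)) as [d1 [Hd1 H1]]; [lra|].
  destruct (HB (eps / 2)) as [d2 [Hd2 H2]]; [lra|].
  exists (Rmin d1 d2); split; [apply Rmin_glb_lt; assumption|]; intros c d Hc Hd Hcd.
  pose proof (Rmin_l d1 d2); pose proof (Rmin_r d1 d2).
  exists (F d - F c); split.
  - apply (is_RInt_derive F f c d); intros y Hy;
      rewrite Rmin_left, Rmax_right in Hy by lra; [apply HF | apply Hf]; lra.
  - assert (E1 := H1 c ltac:(lra) ltac:(lra)); assert (E2 := H2 d ltac:(lra) ltac:(lra)).
    apply Rabs_def2 in E1; apply Rabs_def2 in E2; apply Rabs_def1; lra.
Qed.

(** * Beta integrals *)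

(** One family for two purposes: the Jacobi weight when x = 1, and the fractional kernel times a
    power of 1 + y for general x. *)
Definition wgt (x p q y : R) : R := Rpower (x - y) p * Rpower (1 + y) q.

Lemma Rpower_small p eps : 0 < p -> 0 < eps ->
  exists delta, 0 < delta /\ forall t, 0 < t < delta -> Rpower t p < eps.
Proof.
  intros Hp He; exists (Rpower eps (/ p)); split; [apply exp_pos|]; intros t Ht.
  replace eps with (Rpower (Rpower eps (/ p)) p).
  - apply Rlt_Rpower_l; lra.
  - rewrite Rpower_mult, Rinv_l, Rpower_1; lra.
Qed.

Lemma Rpower_gt0 x p : 0 < Rpower x p.
Proof. apply exp_pos. Qed.

Lemma Rpower_S x p : 0 < x -> Rpower x (p + 1) = x * Rpower x p.
Proof. intros Hx; rewrite Rpower_plus, Rpower_1 by exact Hx; ring. Qed.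

(** Writing x - y as (1 + x) - (1 + y), the integrand is the derivative of [wgt x (p + 1) (q + 1)],
    which tends to 0 at both ends. *)
Lemma impr_wgt_deriv x p q : -1 < x -> -1 < p -> -1 < q ->
  impr (fun y => (q + 1) * (1 + x) * wgt x p q y - (p + q + 2) * wgt x p (q + 1) y) (-1) x 0.
Proof.
  intros Hx Hp Hq; replace 0 with (0 - 0) by ring.
  apply impr_FTC with (wgt x (p + 1) (q + 1)); [exact Hx| | | |].
  - intros y Hy; unfold wgt.
    rewrite (Rpower_S (1 + y) q) by lra.
    unfold Rpower; auto_derive; [lra|].
    change (x + - y) with (x - y).
    fold (Rpower (x - y) (p + 1)); fold (Rpower (1 + y) (q + 1));
      fold (Rpower (x - y) p); fold (Rpower (1 + y) q).
    rewrite !Rpower_S by lra; field; lra.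
  - intros y Hy; apply (ex_derive_continuous (K := R_AbsRing) (V := R_NormedModule)).
    unfold wgt, Rpower; auto_derive; lra.
  - intros eps Heps.
    set (C := Rpower (1 + x) (p + 1)).
    assert (HC : 0 < C) by apply exp_pos.
    destruct (Rpower_small (q + 1) (eps / C)) as [d [Hd H]];
      [lra | apply Rdiv_lt_0_compat; lra|].
    exists d; split; [exact Hd|]; intros y Hy Hy'.
    assert (H1 := H (1 + y) ltac:(lra)).
    rewrite Rminus_0_r, Rabs_pos_eq;
      [|unfold wgt; apply Rmult_le_pos; left; apply Rpower_gt0].
    replace eps with (C * (eps / C)) by (field; lra); unfold wgt.
    apply Rmult_le_0_lt_compat; try (left; apply Rpower_gt0); [|exact H1].
    apply Rlt_Rpower_l; lra.
  - intros eps Heps.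
    set (C := Rpower (1 + x) (q + 1)).
    assert (HC : 0 < C) by apply exp_pos.
    destruct (Rpower_small (p + 1) (eps / C)) as [d [Hd H]];
      [lra | apply Rdiv_lt_0_compat; lra|].
    exists d; split; [exact Hd|]; intros y Hy Hy'.
    assert (H1 := H (x - y) ltac:(lra)).
    rewrite Rminus_0_r, Rabs_pos_eq;
      [|unfold wgt; apply Rmult_le_pos; left; apply Rpower_gt0].
    replace eps with ((eps / C) * C) by (field; lra); unfold wgt.
    apply Rmult_le_0_lt_compat; try (left; apply Rpower_gt0); [exact H1|].
    apply Rlt_Rpower_l; lra.
Qed.

Lemma impr_wgt_q x p q v : -1 < x -> -1 < p -> -1 < q -> impr (wgt x p q) (-1) x v ->
  impr (wgt x p (q + 1)) (-1) x ((q + 1) * (1 + x) / (p + q + 2) * v).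
Proof.
  intros Hx Hp Hq H.
  pose proof (impr_lin _ _ _ _ _ _ ((q + 1) * (1 + x) / (p + q + 2)) (- / (p + q + 2))
    H (impr_wgt_deriv x p q Hx Hp Hq)) as E.
  rewrite Rmult_0_r, Rplus_0_r in E.
  apply impr_ext with (2 := E); intros y Hy; field; lra.
Qed.

Lemma impr_wgt_0 x p : -1 < x -> -1 < p ->
  impr (wgt x p 0) (-1) x (Rpower (1 + x) (p + 1) / (p + 1)).
Proof.
  intros Hx Hp.
  set (F := fun y => - Rpower (x - y) (p + 1) / (p + 1)).
  assert (HF : forall y, y < x -> is_derive F y (Rpower (x - y) p)).
  { intros y Hy; unfold F, Rpower; auto_derive; [lra|].
    change (x + - y) with (x - y).
    fold (Rpower (x - y) (p + 1)); fold (Rpower (x - y) p).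
    rewrite Rpower_S by lra; field; lra. }
  apply impr_ext with (fun y => Rpower (x - y) p).
  { intros y Hy; unfold wgt; rewrite Rpower_O by lra; ring. }
  replace (Rpower (1 + x) (p + 1) / (p + 1)) with (0 - F (-1)) by
    (unfold F; replace (x - -1) with (1 + x) by ring; field; lra).
  apply impr_FTC with F; [exact Hx| | | |].
  - intros y Hy; apply HF; lra.
  - intros y Hy; apply (ex_derive_continuous (K := R_AbsRing) (V := R_NormedModule)).
    unfold Rpower; auto_derive; lra.
  - intros eps Heps.
    assert (Hc : continuity_pt F (-1)).
    { apply derivable_continuous_pt; exists (Rpower (x - -1) p).
      apply is_derive_Reals, HF, Hx. }
    destruct (Hc eps Heps) as [d [Hd H]]; exists d; split; [exact Hd|].
    intros y Hy Hy'; apply H; split; [split; [exact I | lra]|].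
    simpl; unfold Rdist; rewrite Rabs_pos_eq; lra.
  - intros eps Heps.
    destruct (Rpower_small (p + 1) (eps * (p + 1))) as [d [Hd H]]; [lra | nra|].
    exists d; split; [exact Hd|]; intros y Hy Hy'.
    assert (H1 := H (x - y) ltac:(lra)); pose proof (Rpower_gt0 (x - y) (p + 1)) as H2.
    assert (H3 : 0 < Rpower (x - y) (p + 1) / (p + 1)) by (apply Rdiv_lt_0_compat; lra).
    assert (H4 : Rpower (x - y) (p + 1) / (p + 1) < eps).
    { apply Rmult_lt_reg_r with (p + 1); [lra|].
      unfold Rdiv; rewrite Rmult_assoc, Rinv_l by lra; lra. }
    unfold F; rewrite Rminus_0_r; unfold Rdiv; rewrite Ropp_mult_distr_l_reverse, Rabs_Ropp.
    rewrite Rabs_pos_eq; unfold Rdiv in *; lra.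
Qed.

Lemma impr_wgt_poch x p q v n : -1 < x -> -1 < p -> -1 < q -> impr (wgt x p q) (-1) x v ->
  impr (wgt x p (q + INR n)) (-1) x ((1 + x) ^ n * (poch (q + 1) n / poch (p + q + 2) n) * v).
Proof.
  intros Hx Hp Hq H; induction n as [|n IH].
  - simpl (INR 0); rewrite Rplus_0_r; unfold poch; simpl.
    replace (1 * (1 / 1) * v) with v by field; exact H.
  - pose proof (pos_INR n).
    pose proof (impr_wgt_q x p (q + INR n) _ Hx Hp ltac:(lra) IH) as E.
    rewrite S_INR, <- Rplus_assoc, !pochS.
    replace ((1 + x) ^ S n * (poch (q + 1) n * (q + 1 + INR n) /
      (poch (p + q + 2) n * (p + q + 2 + INR n))) * v) with
      ((q + INR n + 1) * (1 + x) / (p + (q + INR n) + 2) *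
       ((1 + x) ^ n * (poch (q + 1) n / poch (p + q + 2) n) * v)); [exact E|].
    pose proof (poch_pos (p + q + 2) n ltac:(lra)); simpl; field; repeat split; lra.
Qed.

(** After division by 2^q the integrand carries ((1 + y) / 2)^q, which decreases in q since (1 + y)
    / 2 < 1. *)
Lemma beta_mono p q q' u u' : q <= q' ->
  impr (wgt 1 p q) (-1) 1 (Rpower 2 q * u) -> impr (wgt 1 p q') (-1) 1 (Rpower 2 q' * u') ->
  u' <= u.
Proof.
  intros Hq H H'.
  (* The second coefficient 0 turns [impr_lin] into a scaling rule, here and in later uses. *)
  pose proof (impr_lin _ _ _ _ _ _ (Rpower 2 (- q)) 0 H H) as E.
  pose proof (impr_lin _ _ _ _ _ _ (Rpower 2 (- q')) 0 H' H') as E'.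
  assert (S : forall r t, Rpower 2 (- r) * (Rpower 2 r * t) + 0 * (Rpower 2 r * t) = t).
  { intros r t; rewrite <- Rmult_assoc, <- Rpower_plus, Rplus_opp_l, Rpower_O by lra; ring. }
  rewrite S in E, E'.
  apply (fun h => impr_le _ _ (-1) 1 _ _ ltac:(lra) h E' E).
  intros y Hy; rewrite !Rmult_0_l, !Rplus_0_r; unfold wgt.
  assert (T : forall r, Rpower 2 (- r) * (Rpower (1 - y) p * Rpower (1 + y) r) =
     Rpower (1 - y) p * exp (- (r * (ln 2 - ln (1 + y))))).
  { intros r; unfold Rpower; rewrite (Rmult_comm _ (_ * _)), Rmult_assoc, <- exp_plus.
    do 2 f_equal; ring. }
  rewrite !T; apply Rmult_le_compat_l; [left; apply Rpower_gt0|].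
  apply exp_le_compat, Ropp_le_contravar, Rmult_le_compat_r; [|exact Hq].
  assert (ln (1 + y) < ln 2) by (apply ln_increasing; lra); lra.
Qed.

(* Raising the exponent [b] by [n], the integral behaves like [n^-(a+1)] times
   [Gamma (a+b+2) / Gamma (b+1)]; for integral [b] this is Gauss's product for
   [Gamma (a+1)], and monotonicity in [b] interpolates between integers. *)
Lemma beta_integral a b v : -1 < a -> -1 < b -> impr (wgt 1 a b) (-1) 1 v ->
  v = Rpower 2 (a + b + 1) * Gamma (a + 1) * Gamma (b + 1) / Gamma (a + b + 2).
Proof.
  intros Ha Hb H.
  set (u := v / Rpower 2 b).
  set (X := fun n => u * (poch (b + 1) n / poch (a + b + 2) n)).
  set (Y := fun n => Rpower 2 (a + 1) / (a + 1) * (poch 1 n / poch (a + 2) n)).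
  assert (H2 : forall n, Rpower 2 (INR n) = 2 ^ n) by (intros n; apply Rpower_pow; lra).
  assert (HX : forall n, impr (wgt 1 a (b + INR n)) (-1) 1 (Rpower 2 (b + INR n) * X n)).
  { intros n; pose proof (impr_wgt_poch 1 a b v n ltac:(lra) Ha Hb H) as E.
    replace (Rpower 2 (b + INR n) * X n) with
      ((1 + 1) ^ n * (poch (b + 1) n / poch (a + b + 2) n) * v); [exact E|].
    unfold X, u; rewrite Rpower_plus, H2; replace (1 + 1) with 2 by ring.
    pose proof (Rpower_gt0 2 b); pose proof (poch_pos (a + b + 2) n ltac:(lra)).
    field; lra. }
  assert (HY : forall n, impr (wgt 1 a (INR n)) (-1) 1 (Rpower 2 (INR n) * Y n)).
  { intros n.
    pose proof (impr_wgt_poch 1 a 0 _ n ltac:(lra) Ha ltac:(lra)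
      (impr_wgt_0 1 a ltac:(lra) Ha)) as E.
    rewrite !Rplus_0_l, Rplus_0_r in E.
    replace (Rpower 2 (INR n) * Y n) with
      ((1 + 1) ^ n * (poch 1 n / poch (a + 2) n) * (Rpower (1 + 1) (a + 1) / (a + 1)));
      [exact E|].
    unfold Y; rewrite H2; replace (1 + 1) with 2 by ring; ring. }
  (* Then n + K lies between b + n and b + n + 1, so [beta_mono] places Y (n + K) between X (n + 1)
     and X n. Multiplied by n^(a+1), these two have the same limit. *)
  assert (HK : exists K, b <= INR K <= b + 1).
  { destruct (archimed b) as [U1 U2]; exists (Z.to_nat (up b)).
    assert (0 <= up b)%Z.
    { assert (-1 < up b)%Z by (apply lt_IZR; lra); lia. }
    rewrite INR_IZR_INZ, Z2Nat.id by assumption; lra. }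
  destruct HK as [K HK].
  (* The denominator of [gseq] has one factor more than [poch _ n] in X; the surplus is a ratio
     tending to 1. *)
  assert (LX : is_lim_seq (fun n => Rpower (INR n) (a + 1) * X n)
                 (u * (Gamma (a + b + 2) / Gamma (b + 1)))).
  { apply is_lim_seq_ext_loc with (fun n => u * (gseq (a + b + 2) n / gseq (b + 1) n *
      ((INR n + (a + b + 2)) / (INR n + (b + 1))))).
    - exists 1%nat; intros n Hn; unfold X, gseq; rewrite !pochS.
      assert (Hn' : 0 < INR n) by (apply lt_0_INR; lia).
      replace (a + b + 2) with (a + 1 + (b + 1)) by ring.
      rewrite Rpower_plus.
      pose proof (poch_pos (a + 1 + (b + 1)) n ltac:(lra)).
      pose proof (poch_pos (b + 1) n ltac:(lra)).
      pose proof (Rpower_gt0 (INR n) (b + 1)); pose proof (INR_fact_lt_0 n).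
      field; repeat split; lra.
    - replace (Gamma (a + b + 2) / Gamma (b + 1)) with
        (Gamma (a + b + 2) / Gamma (b + 1) * 1) by ring.
      apply (is_lim_seq_scal_l _ u (Finite (_ * 1))).
      apply is_lim_seq_mult'; [|apply is_lim_seq_ratio].
      apply is_lim_seq_div'; try (apply Gamma_lim; lra).
      pose proof (Gamma_pos (b + 1) ltac:(lra)); lra. }
  assert (LX' : is_lim_seq (fun n => Rpower (INR n) (a + 1) * X (S n))
                  (u * (Gamma (a + b + 2) / Gamma (b + 1)))).
  { apply is_lim_seq_ext with (fun n => Rpower (INR n) (a + 1) * X n *
      ((INR n + (b + 1)) / (INR n + (a + b + 2)))).
    - intros n; unfold X; rewrite !pochS; pose proof (pos_INR n).
      pose proof (poch_pos (a + b + 2) n ltac:(lra)); field; lra.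
    - replace (Finite (u * (Gamma (a + b + 2) / Gamma (b + 1)))) with
        (Finite (u * (Gamma (a + b + 2) / Gamma (b + 1)) * 1)) by (f_equal; ring).
      apply is_lim_seq_mult'; [exact LX | apply is_lim_seq_ratio]. }
  assert (LY : forall k, is_lim_seq (fun n => Rpower (INR n) (a + 1) * Y (n + k)%nat)
                 (Rpower 2 (a + 1) * Gamma (a + 1))).
  { induction k as [|k IH].
    - apply is_lim_seq_ext with (fun n => Rpower 2 (a + 1) * gseq (a + 1) n).
      + intros n; unfold Y, gseq; rewrite Nat.add_0_r, poch_1, pochSl.
        replace (a + 1 + 1) with (a + 2) by ring.
        pose proof (poch_pos (a + 2) n ltac:(lra)); field; lra.
      + apply (is_lim_seq_scal_l _ _ (Finite (Gamma (a + 1)))), Gamma_lim; lra.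
    - apply is_lim_seq_ext with (fun n => Rpower (INR n) (a + 1) * Y (n + k)%nat *
        ((INR n + (INR k + 1)) / (INR n + (INR k + a + 2)))).
      + intros n; rewrite Nat.add_succ_r; unfold Y; rewrite !pochS, plus_INR.
        pose proof (pos_INR n); pose proof (pos_INR k).
        pose proof (poch_pos (a + 2) (n + k) ltac:(lra)); field; lra.
      + replace (Finite (Rpower 2 (a + 1) * Gamma (a + 1))) with
          (Finite (Rpower 2 (a + 1) * Gamma (a + 1) * 1)) by (f_equal; ring).
        apply is_lim_seq_mult'; [exact IH | apply is_lim_seq_ratio]. }
  assert (E : u * (Gamma (a + b + 2) / Gamma (b + 1)) = Rpower 2 (a + 1) * Gamma (a + 1)).
  { apply Rle_antisym.
    - apply (is_lim_seq_le _ _ (Finite _) (Finite _)) with (2 := LX') (3 := LY K).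
      intros n; apply Rmult_le_compat_l; [left; apply Rpower_gt0|].
      apply (beta_mono a (INR (n + K)) (b + INR (S n))); [|apply HY | apply HX].
      rewrite plus_INR, S_INR; lra.
    - apply (is_lim_seq_le _ _ (Finite _) (Finite _)) with (2 := LY K) (3 := LX).
      intros n; apply Rmult_le_compat_l; [left; apply Rpower_gt0|].
      apply (beta_mono a (b + INR n) (INR (n + K))); [|apply HX | apply HY].
      rewrite plus_INR; lra. }
  pose proof (Gamma_pos (a + b + 2) ltac:(lra)); pose proof (Gamma_pos (b + 1) ltac:(lra)).
  pose proof (Rpower_gt0 2 b).
  replace (a + b + 1) with (a + 1 + b) by ring; rewrite Rpower_plus.
  replace v with (u * Rpower 2 b) by (unfold u; field; lra).
  replace u with (u * (Gamma (a + b + 2) / Gamma (b + 1)) * (Gamma (b + 1) / Gamma (a + b + 2)))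
    by (field; lra).
  rewrite E; field; lra.
Qed.

(** The exponent of 1 + y is an integer, so the elementary case q = 0 and k contiguity steps
    suffice, without the Beta integral. The leading [Gamma rho] is the normalization of the
    fractional integral. *)
Lemma frac_int_monomial x rho k : -1 < x -> 0 < rho ->
  impr (fun y => Rpower (x - y) (rho - 1) * (1 + y) ^ k) (-1) x
    (Gamma rho * (Rpower (1 + x) rho * (INR (fact k) / Gamma (rho + INR k + 1) * (1 + x) ^ k))).
Proof.
  intros Hx Hr.
  pose proof (impr_wgt_poch x (rho - 1) 0 _ k Hx ltac:(lra) ltac:(lra)
    (impr_wgt_0 x (rho - 1) Hx ltac:(lra))) as E.
  replace (rho - 1 + 0 + 2) with (rho + 1) in E by ring.
  replace (rho - 1 + 1) with rho in E by ring.
  rewrite !Rplus_0_l, poch_1 in E.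
  replace (rho + INR k + 1) with (rho + INR (S k)) by (rewrite S_INR; ring).
  rewrite Gamma_poch, pochSl by exact Hr.
  pose proof (Gamma_pos rho Hr); pose proof (poch_pos (rho + 1) k ltac:(lra)).
  match type of E with impr _ _ _ ?v => match goal with |- impr _ _ _ ?w =>
    replace w with v by (field; lra) end end.
  apply impr_ext with (2 := E); intros y Hy; unfold wgt.
  rewrite Rpower_pow by lra; reflexivity.
Qed.

(** * Total mass and moments of the Jacobi weight, and the constants [gam] *)

Definition mass (a b : R) : R :=
  Rpower 2 (a + b + 1) * Gamma (a + 1) * Gamma (b + 1) / Gamma (a + b + 2).

(** The power of (1 - y) / 2 only raises the exponent a by k, which leaves a Beta integral. That the
    integral exists is an input, supplied later by the quadrature hypothesis. *)
Lemma weighted_moment a b k v : -1 < a -> -1 < b ->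
  improper_int (fun y => ((1 - y) / 2) ^ k * Rpower (1 - y) a * Rpower (1 + y) b) (-1) 1 v ->
  v = mass a b * (poch (a + 1) k / poch (a + b + 2) k).
Proof.
  intros Ha Hb H; apply improper_intE in H.
  pose proof (pos_INR k).
  assert (H2 : 0 < 2 ^ k) by (apply pow_lt; lra).
  assert (E : impr (wgt 1 (a + INR k) b) (-1) 1 (2 ^ k * v + 0 * v)).
  { apply impr_ext with (2 := impr_lin _ _ _ _ _ _ (2 ^ k) 0 H H).
    intros y Hy; unfold wgt.
    unfold Rdiv; rewrite Rpower_plus, Rpower_pow, Rpow_mult_distr, pow_inv by lra; field; lra. }
  apply beta_integral in E; [|lra|exact Hb].
  replace (a + INR k + b + 1) with (a + b + 1 + INR k) in E by ring.
  replace (a + INR k + b + 2) with (a + b + 2 + INR k) in E by ring.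
  replace (a + INR k + 1) with (a + 1 + INR k) in E by ring.
  rewrite Rpower_plus, Rpower_pow, !Gamma_poch in E by lra.
  pose proof (Gamma_pos (a + b + 2) ltac:(lra)).
  pose proof (poch_pos (a + b + 2) k ltac:(lra)).
  apply Rmult_eq_reg_l with (2 ^ k); [|lra].
  replace (2 ^ k * v) with (2 ^ k * v + 0 * v) by ring.
  rewrite E; unfold mass; field; lra.
Qed.

Lemma massS a b : -1 < a -> -1 < b ->
  mass (a + 1) (b + 1) = 4 * ((a + 1) * (b + 1) / ((a + b + 2) * (a + b + 3))) * mass a b.
Proof.
  intros Ha Hb; unfold mass.
  replace (a + 1 + (b + 1) + 1) with (a + b + 1 + INR 2) by (simpl; ring).
  replace (a + 1 + (b + 1) + 2) with (a + b + 2 + 1 + 1) by ring.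
  rewrite Rpower_plus, Rpower_pow, (Gamma_succ (a + 1)), (Gamma_succ (b + 1)),
    (Gamma_succ (a + b + 2 + 1)), (Gamma_succ (a + b + 2)) by lra.
  pose proof (Gamma_pos (a + b + 2) ltac:(lra)); field; lra.
Qed.

(** The bound on a + b + 1 keeps the argument of [Gamma] in the denominator positive. *)
Lemma gam0 a b : -1 < a -> -1 < b -> 0 < a + b + 1 -> gam a b 0 = mass a b.
Proof.
  intros Ha Hb Hab; unfold gam, mass; simpl (INR _); rewrite !Rplus_0_l.
  replace (a + b + 2) with (a + b + 1 + 1) by ring; rewrite (Gamma_succ (a + b + 1)) by lra.
  pose proof (Gamma_pos (a + b + 1) ltac:(lra)); field; lra.
Qed.

(** The step of the recursion [jnorm]. The factor 1/4 offsets the growth of the power of 2 and meets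
    the 4 of [massS]. *)
Lemma gamS a b n : -1 < a -> -1 < b ->
  gam a b (S n) = (INR n + a + b + 2) / (INR n + 1) * / 4 * gam (a + 1) (b + 1) n.
Proof.
  intros Ha Hb; unfold gam; pose proof (pos_INR n).
  rewrite fact_simpl, mult_INR, S_INR.
  replace (INR n + 1 + a + 1) with (INR n + (a + 1) + 1) by ring.
  replace (INR n + 1 + b + 1) with (INR n + (b + 1) + 1) by ring.
  replace (INR n + 1 + a + b + 1) with (INR n + a + b + 2) by ring.
  replace (INR n + (a + 1) + (b + 1) + 1) with (INR n + a + b + 2 + 1) by ring.
  rewrite (Gamma_succ (INR n + a + b + 2)) by lra.
  replace (a + 1 + (b + 1) + 1) with (a + b + 1 + INR 2) by (simpl; ring).
  rewrite (Rpower_plus _ (INR 2)), Rpower_pow by lra.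
  pose proof (Gamma_pos (INR n + a + b + 2) ltac:(lra)); pose proof (INR_fact_lt_0 n).
  field; repeat split; lra.
Qed.

(** The integral of 1 over [-1, 1] is 2 by direct computation and 2 Gamma(1)^2 / Gamma(2) by the
    Beta formula. *)
Lemma Gamma_1 : Gamma 1 = 1.
Proof.
  pose proof (beta_integral 0 0 _ ltac:(lra) ltac:(lra)
    (impr_wgt_0 1 0 ltac:(lra) ltac:(lra))) as E.
  rewrite !Rplus_0_l, Rpower_1 in E by lra.
  replace 2 with (1 + 1) in E by ring.
  rewrite Gamma_succ, Rpower_1 in E by lra.
  pose proof (Gamma_pos 1 ltac:(lra)).
  replace ((1 + 1) * Gamma 1 * Gamma 1 / (1 * Gamma 1)) 
    with ((1 + 1) * Gamma 1) in E by (field; lra).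
  lra.
Qed.

Lemma mass00 : mass 0 0 = 2.
Proof.
  unfold mass; rewrite !Rplus_0_l, Rpower_1 by lra.
  replace (Gamma 2) with (Gamma (1 + 1)) by (f_equal; ring).
  rewrite Gamma_succ, Gamma_1 by lra; field.
Qed.

Lemma gam00 n : gam 0 0 n = 2 / (2 * INR n + 1).
Proof.
  unfold gam; rewrite !Rplus_0_r, Rplus_0_l, Rpower_1 by lra.
  rewrite (Rplus_comm (INR n) 1), Gamma_poch, poch_1, Gamma_1 by lra.
  pose proof (INR_fact_lt_0 n); pose proof (pos_INR n); field; lra.
Qed.

(** * Finite sums and termwise integration *)

Lemma rsum_ext n f g : (forall k, (k < n)%nat -> f k = g k) -> rsum n f = rsum n g.
Proof.
  induction n as [|n IH]; intros H; simpl; [reflexivity|].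
  rewrite IH, H; auto.
Qed.

Lemma rsum_scal n c f : rsum n (fun k => c * f k) = c * rsum n f.
Proof. induction n as [|n IH]; simpl; [ring | rewrite IH; ring]. Qed.

Lemma rsum_recl n f : rsum (S n) f = f O + rsum n (fun k => f (S k)).
Proof.
  induction n as [|n IH]; [simpl; ring|].
  change (rsum (S (S n)) f) with (rsum (S n) f + f (S n)).
  rewrite IH; simpl; ring.
Qed.

Lemma impr_rsum n (f : nat -> R -> R) (v : nat -> R) a b :
  (forall k, (k < n)%nat -> impr (f k) a b (v k)) ->
  impr (fun y => rsum n (fun k => f k y)) a b (rsum n v).
Proof.
  induction n as [|n IH]; intros H; simpl.
  - intros eps Heps; exists 1; split; [lra|]; intros c d _ _ _.
    exists 0; split; [|rewrite Rminus_0_r, Rabs_R0; exact Heps].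
    assert (E : is_RInt (fun _ : R => 0) c d ((d - c) * 0)) by
      apply (is_RInt_const (V := R_NormedModule)).
    rewrite Rmult_0_r in E; exact E.
  - pose proof (impr_lin _ _ _ _ _ _ 1 1 (IH (fun k Hk => H k (Nat.lt_lt_succ_r _ _ Hk)))
      (H n (Nat.lt_succ_diag_r n))) as E.
    replace (rsum n v + v n) with (1 * rsum n v + 1 * v n) by ring.
    apply impr_ext with (2 := E); intros y _; ring.
Qed.

End BetaGamma.

Module Transfer.
Import HB.structures all_boot all_order all_algebra ring lra zify Rstruct.
Set Implicit Arguments. Unset Strict Implicit. Unset Printing Implicit Defensive.
Import Order.TTheory GRing.Theory Num.Theory.
Import ClassicalEpsilon JacobiAlgebra BetaGamma.
Delimit Scope R_scope with coqR.
Local Open Scope ring_scope.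

(** * Transfer to real functions *)

Implicit Types (a b : R) (p q : {poly R}) (n k : nat).

Lemma RtwoE : IZR 2 = 2%:R :> R.
Proof. by rewrite -INRE. Qed.

Lemma RN1E : IZR (-1) = -1 :> R.
Proof. by rewrite -R1E -RoppE. Qed.

Definition RE := (RplusE, RminusE, RmultE, RoppE, RinvE, RdivE, INRE,
  factE, RpowE, R0E, R1E, RN1E, RtwoE).

Lemma rsumE n (f : nat -> R) : rsum n f = \sum_(i < n) f i.
Proof. by elim: n => [|n IH]; rewrite ?big_ord0 // big_ord_recr /= IH. Qed.

Lemma rprodE n (f : nat -> R) : rprod n f = \prod_(i < n) f i.
Proof. by elim: n => [|n IH]; rewrite ?big_ord0 // big_ord_recr /= IH. Qed.

Lemma pochE a k : poch a k = rising a k.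
Proof. by rewrite /poch rprodE; apply: eq_bigr => i _; rewrite !RE. Qed.

Definition toS (y : R) := ((1 - y) / 2%:R)%R.

Lemma jacobiE a b n (y : R) : jacobi a b n y = (jac a b n).[toS y].
Proof.
rewrite /jacobi rsumE /jac horner_poly !RE pochE big_distrr /=; apply: eq_bigr => k _.
by rewrite !pochE !RE /jcoef !mulrA.
Qed.

Lemma derivable_horner p (y : R) : derivable_pt_lim (fun t => p.[t]) y (p^`().[y]).
Proof.
elim/poly_ind: p => [|p c IH].
  rewrite deriv0 horner0; apply: (derivable_pt_lim_ext (fct_cte 0)).
    by move=> t; rewrite horner0.
  exact: derivable_pt_lim_const.
rewrite derivD derivC addr0 derivM derivX mulr1 hornerD hornerM hornerX.
apply: (derivable_pt_lim_ext (fun t => Rplus (Rmult p.[t] t) c)).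
  by move=> t; rewrite hornerD hornerM hornerX hornerC !RE.
have -> : p^`().[y] * y + p.[y] = (p^`().[y] * y + p.[y] * 1 + 0)%coqR by rewrite !RE mulr1 addr0.
apply: (derivable_pt_lim_plus (fun t => p.[t] * t)%coqR (fct_cte c)).
  2: exact: derivable_pt_lim_const.
apply: (derivable_pt_lim_mult (fun t => p.[t]) id) => //; exact: derivable_pt_lim_id.
Qed.

Lemma derivable_horner_toS p (y : R) :
  derivable_pt_lim (fun t => p.[toS t]) y (- (2%:R^-1) * p^`().[toS y]).
Proof.
rewrite mulrC -RmultE; apply: (derivable_pt_lim_comp toS (fun t => p.[t])); last first.
  exact: derivable_horner.
apply: (derivable_pt_lim_ext (fun t => Rplus (2%:R^-1 : R) (Rmult (- (2%:R^-1 : R)) t))).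
  by move=> t; rewrite !RE /toS; field.
have -> : - (2%:R^-1) = (0 + - (2%:R^-1 : R) * 1)%coqR :> R by rewrite !RE mulr1 add0r.
apply: (derivable_pt_lim_plus (fct_cte _)); first exact: derivable_pt_lim_const.
apply: (derivable_pt_lim_scal id); exact: derivable_pt_lim_id.
Qed.

Lemma jacobi_reflect a b n (y : R) : -1 < a -> -1 < b ->
  jacobi b a n (- y) = (-1) ^+ n * jacobi a b n y.
Proof.
move=> a1 b1; rewrite !jacobiE -hornerZ -jac_reflect // horner_comp !hornerE.
by congr (_.[_]); rewrite /toS !RE; field.
Qed.

(** * Lagrange basis polynomials in the variable s *)

Definition lagp N (s : nat -> R) j : {poly R} :=
  \prod_(k < N.+1) (if k == j :> nat then 1 else (s j - s k)^-1 *: ('X - (s k)%:P)).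

(** Numerator and denominator of each factor are scaled by the same -1/2 under the affine change of
    variable. *)
Lemma lagrE N (x : nat -> R) j (y : R) :
  lagr N x j y = (lagp N (fun k => toS (x k)) j).[toS y].
Proof.
rewrite /lagr rprodE /lagp horner_prod; apply: eq_bigr => k _.
have -> : Nat.eqb k j = (k == j :> nat).
  by apply/idP/eqP => [/Nat.eqb_eq|->]; rewrite ?Nat.eqb_refl.
case: eqP => _; first by rewrite hornerC.
rewrite !RE hornerZ !hornerE.
have -> : toS y - toS (x k) = - (2%:R^-1) * (y - x k) by rewrite /toS; field.
have -> : toS (x j) - toS (x k) = - (2%:R^-1) * (x j - x k) by rewrite /toS; field.
have h : - 2%:R^-1 != 0 :> R by rewrite oppr_eq0 invr_eq0 pnatr_eq0.
by rewrite [RHS]mulrC -mulf_div divff // mul1r.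
Qed.

Lemma size_lagp N s j : (j <= N)%N -> (size (lagp N s j) <= N.+1)%N.
Proof.
move=> jN; apply: leq_trans (size_prod_leq _ _) _.
have h : forall k : 'I_N.+1,
    (size (if (k == j :> nat)%N then 1 else (s j - s k)^-1 *: ('X - (s k)%:P) : {poly R})%R
   <= (k != inord j) + 1)%N.
  move=> k; have -> : (k != inord j) = (k != j :> nat).
    by rewrite -val_eqE /= inordK.
  case: eqP => _; first by rewrite size_poly1.
  by apply: leq_trans (size_scale_leq _ _) _; rewrite size_XsubC.
rewrite leq_subLR addnS ltnS; apply: leq_trans; first by apply: leq_sum => k _; exact: h.
rewrite big_split /= sum1_card (bigD1 (inord j)) //= eqxx add0n.
have -> : (\sum_(i < N.+1 | i != inord j) (i != inord j) = \sum_(i < N.+1 | i != inord j) 1)%N.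
  by apply: eq_bigr => i ->.
by rewrite sum1_card cardC1 card_ord /=; lia.
Qed.

Lemma lagp_node N s j i : (j <= N)%N -> (i <= N)%N ->
  (forall k l, (k <= N)%N -> (l <= N)%N -> s k = s l -> k = l) ->
  (lagp N s j).[s i] = (i == j)%:R.
Proof.
move=> jN iN inj; rewrite /lagp horner_prod; case: eqVneq => [->|ij].
  rewrite big1 // => k _; case: eqVneq => kj; first by rewrite hornerC.
  rewrite hornerZ hornerXsubC mulVf // subr_eq0; apply/eqP => e.
  by move: kj; rewrite (inj j k) ?eqxx // leq_ord.
rewrite (bigD1 (inord i)) //= inordK // (negPf ij).
by rewrite hornerZ hornerXsubC subrr mulr0 mul0r.
Qed.

Lemma RthreeE : IZR 3 = 3%:R :> R. Proof. by rewrite -INRE INR_IZR_INZ. Qed.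
Lemma RfourE : IZR 4 = 4%:R :> R. Proof. by rewrite -INRE INR_IZR_INZ. Qed.

Lemma gtN1 a : -1 < a -> (-1 < a)%coqR.
Proof. by move/RltP; rewrite -RN1E. Qed.

(** The side condition only constrains n = 0: one step replaces a + b + 1 by a + b + 3, which is
    positive, so the induction always ends in reach of [gam0]. *)
Lemma gam_jnorm a b n : -1 < a -> -1 < b -> (0 < n)%N || (0 < a + b + 1) ->
  gam a b n = mass a b * jnorm a b n.
Proof.
elim: n a b => [|n IH] a b a1 b1 /=.
  move=> ab; rewrite mulr1; apply: gam0; try exact: gtN1.
  by apply/RltP; rewrite !RE.
move=> _; have hn := ler0n R n.
rewrite (gamS _ _ _ (gtN1 a1) (gtN1 b1)) !RE IH; try by rewrite ?RE; lra.
  rewrite (massS _ _ (gtN1 a1) (gtN1 b1)) !RE RfourE RthreeE.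
  by field; rewrite ?[1 + n%:R]addrC natr1 pnatr_eq0 /= !gt_eqF //; lra.
Qed.

Lemma poly_ext p q : (forall t, p.[t] = q.[t]) -> p = q.
Proof.
move=> h; apply/eqP; rewrite -subr_eq0; set d := p - q.
have hd t : root d t by rewrite /root /d hornerD hornerN h subrr.
apply/eqP; apply: (@roots_geq_poly_eq0 _ d [seq i%:R | i <- iota 0 (size d)]).
- by apply/allP => t _; exact: hd.
- rewrite map_inj_uniq ?iota_uniq // => i j /eqP; rewrite eqr_nat => /eqP; exact.
- by rewrite size_map size_iota.
Qed.

Lemma toSK (t : R) : toS (1 - 2%:R * t)%R = t.
Proof. by rewrite /toS; field. Qed.

Lemma leqbE k n : Nat.leb k n = (k <= n)%N.
Proof. by apply/idP/idP => [/Nat.leb_le/ssrnat.leP|/ssrnat.leP/Nat.leb_le]. Qed.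

(** [conn] is a choice, so some expansion must be exhibited before the chosen one is known to be
    valid; it exists because the degrees of the Legendre polynomials are 0, 1, 2, and so on. *)
Lemma conn_jac a b n : -1 < a -> -1 < b ->
  jac a b n = \sum_(k < n.+1) conn a b (IZR 0) (IZR 0) k n *: jac 0 0 k.
Proof.
move=> a1 b1.
pose Q (c : nat -> R) := forall y,
  jacobi a b n y = rsum n.+1 (fun k => (c k * jacobi 0 0 k y)%coqR).
have hQ : Q (epsilon (inhabits (fun=> IZR 0)) Q).
  apply: epsilon_spec.
  have h0 : -1 < 0 :> R by rewrite ltrN10.
  have [|c E] := @poly_basis _ (jac 0 0) n.+1 (jac a b n) (fun k => size_jac k h0 h0).
    by rewrite size_jac.
  exists c => y; rewrite jacobiE E rsumE horner_sum; apply: eq_bigr => k _.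
  by rewrite hornerZ jacobiE.
apply: poly_ext => t; have := hQ (1 - 2%:R * t)%R.
rewrite jacobiE toSK rsumE horner_sum => ->; apply: eq_bigr => k _.
by rewrite hornerZ jacobiE toSK /conn leqbE leq_ord.
Qed.

Lemma conn_gt a b n k : (n < k)%N -> conn a b (IZR 0) (IZR 0) k n = 0.
Proof. by move=> h; rewrite /conn leqbE leqNgt h. Qed.

(** The integral of ((1 - y) / 2)^k against the Jacobi weight in y, in the closed form of
    [weighted_moment]. *)
Definition jmom a b k : R := (mass a b * (rising (a + 1) k / rising (a + b + 2%:R) k))%R.

Lemma pearson_jmom a b : -1 < a -> -1 < b -> pearson a b (jmom a b).
Proof.
move=> a1 b1 k; rewrite /jmom !risingSr.
have hk := ler0n R k.
have h1 : rising (a + b + 2) k != 0 by rewrite gt_eqF // rising_gt0 //; lra.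
have h2 : a + b + 2 + k%:R != 0 by rewrite gt_eqF //; lra.
by field; rewrite h1 h2.
Qed.

Lemma ltN1D1 a : -1 < a -> -1 < a + 1.
Proof. lra. Qed.

Lemma mass_gt0 a b : -1 < a -> -1 < b -> 0 < mass a b.
Proof.
move=> a1 b1; apply/RltP; rewrite /mass; apply: Rdiv_lt_0_compat; last first.
  by apply: Gamma_pos; apply/RltP; rewrite !RE; lra.
apply: Rmult_lt_0_compat; first apply: Rmult_lt_0_compat; first exact: exp_pos.
  by apply: Gamma_pos; apply/RltP; rewrite !RE; lra.
by apply: Gamma_pos; apply/RltP; rewrite !RE; lra.
Qed.

Lemma jnormt_gt0 N a b n : (0 < N)%N -> -1 < a -> -1 < b -> 0 < jnormt N a b (jmom a b) n.
Proof.
move=> N0 a1 b1; rewrite /jnormt mulr_gt0 //; last first.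
  by rewrite mulr_gt0 ?jnorm_gt0 // /jmom !rising0 divr1 mulr1 mass_gt0.
case: eqP => // _; have hN : 1 <= N%:R :> R by rewrite ler1n.
have -> : 2 + (a + b + 1) / N%:R = (2 * N%:R + (a + b + 1)) / N%:R by field; rewrite gt_eqF //; lra.
by rewrite divr_gt0 //; lra.
Qed.

(** * Expansion of h_j and of its derivative *)

Section Main.
Variables (N : nat) (a b : R) (x w : nat -> R).
Hypotheses (N0 : (0 < N)%N) (a1 : -1 < a) (b1 : -1 < b).
Hypothesis inc : forall i, (i < N)%N -> x i < x i.+1.
Hypothesis nodes : forall j, (j <= N)%N -> forall d,
  derivable_pt_lim (jacobi a b N) (x j) d -> (1 - x j ^+ 2) * d = 0.
Hypothesis weights : forall c : nat -> R,
  improper_int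
    (fun y => (rsum (2 * N) (fun k => c k * y ^ k) * Rpower (1 - y) a * Rpower (1 + y) b)%coqR)
    (IZR (-1)) (IZR 1)
    (rsum N.+1 (fun j => rsum (2 * N) (fun k => c k * x j ^ k) * w j)%coqR).

Let s k := toS (x k).

Lemma node_inj k l : (k <= N)%N -> (l <= N)%N -> s k = s l -> k = l.
Proof.
have lt k' l' : (k' < l')%N -> (l' <= N)%N -> x k' < x l'.
  elim: l' => [//|l' IH]; rewrite ltnS leq_eqVlt => /orP[/eqP -> h|h hl]; first exact: inc.
  by apply: lt_trans (inc hl); apply: IH => //; exact: ltnW.
move=> hk hl e; have {}e : x k = x l.
  have : 1 - 2%:R * s k = 1 - 2%:R * s l by rewrite e.
  have h2 t : 1 - 2%:R * toS t = t by rewrite /toS; field.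
  by rewrite !h2.
case: (ltngtP k l) => // h; [have := lt k l h hl | have := lt l k h hk]; by rewrite e ltxx.
Qed.

Lemma node_zero j : (j <= N)%N -> s j * (1 - s j) * (jac a b N)^`().[s j] = 0.
Proof.
move=> hj; have := nodes hj (derivable_pt_lim_ext _ _ _ _ (fun t => esym (jacobiE a b N t))
  (derivable_horner_toS (jac a b N) (x j))).
rewrite -/(s j).
have -> : x j = 1 - 2%:R * s j by rewrite /s /toS; field.
(* The constant -2 combines 1 - y^2 = 4 s (1 - s) with the chain-rule factor -1/2. *)
move=> h; apply: (@mulfI _ (- 2%:R)); first by rewrite oppr_eq0 pnatr_eq0.
by rewrite mulr0 -h; field.
Qed.

(** Expanded in y, s^k has degree below 2N, so [weights] gives both the existence of its weighted
    integral and the nodal sum equal to it; the Beta formula evaluates the former. *)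
Lemma quad_moment k : (k < 2 * N)%N -> quad N s w 'X^k = jmom a b k.
Proof.
move=> hk; pose p : {poly R} := (2%:R^-1 *: (1 - 'X)) ^+ k.
have sp : (size p <= 2 * N)%N.
  apply: leq_trans (size_poly_exp_leq _ _) _; apply: leq_trans hk; rewrite ltnS.
  rewrite -[X in (_ <= X)%N]mul1n leq_mul2r; apply/orP; right.
  have h : (size (2%:R^-1 *: (1 - 'X : {poly R}))%R <= 2)%N.
    apply: leq_trans (size_scale_leq _ _) _.
    by rewrite -opprB size_polyN -polyC1 size_XsubC.
  by case: (size _) h => [//|m].
have E (y : R) : rsum (2 * N) (fun i => (p`_i * y ^ i)%coqR) = toS y ^+ k.
  rewrite rsumE; under eq_bigr do rewrite RE RpowE.
  rewrite -horner_coef_wide // /p horner_exp hornerZ !hornerE.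
  by congr (_ ^+ _); rewrite /toS mulrC.
have W := weights (fun i => p`_i).
have -> : quad N s w 'X^k =
   rsum N.+1 (fun j => (rsum (2 * N) (fun i => p`_i * x j ^ i) * w j)%coqR).
  rewrite rsumE; apply: eq_bigr => j _; rewrite RE.
  by rewrite [in RHS]E hornerXn.
transitivity (Rmult (mass a b) (poch (a + 1) k / poch (a + b + 2) k)%coqR).
  apply: (weighted_moment a b k _ (gtN1 a1) (gtN1 b1)).
  apply/improper_intE; apply: (impr_ext _ _ _ _ _ _ (proj1 (improper_intE _ _ _ _) W)).
  by move=> y _; cbv beta; rewrite E /toS !RE.
by rewrite /jmom !pochE !RE.
Qed.

Lemma gamt_jnormt n : (0 < n <= N)%N -> gamt N a b n = jnormt N a b (jmom a b) n.
Proof.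
case/andP=> n0 nN; rewrite /jnormt {1}/jmom !rising0 divr1 mulr1 -gam_jnorm ?n0 // /gamt.
have -> : Nat.eqb n N = (n == N) by apply/idP/eqP => [/Nat.eqb_eq|->]; rewrite ?Nat.eqb_refl.
by case: eqP => [->|_]; rewrite ?mul1r // !RE.
Qed.

(** The mode n = 0 is left as an unnamed constant: [gamt] is identified with the discrete norm for n
    > 0 only, and differentiation removes this mode. *)
Lemma lagp_expand j : (j <= N)%N -> exists c0 : R,
  lagp N s j = c0%:P + \sum_(n < N) tcoef N a b x w n.+1 j *: jac a b n.+1.
Proof.
move=> hj.
have [c [E hc]] := @lagrange_jac_coef _ N a b (jmom a b) s w N0 a1 b1 (pearson_jmom a1 b1)
  node_zero quad_moment (lagp N s j) j hj (size_lagp s hj)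
  (fun i hi => lagp_node hj hi node_inj).
exists (c 0%N); rewrite E big_ord_recl jac0 /= -alg_polyC; congr (_ + _).
apply: eq_bigr => n _; congr (_ *: _); have hn : (0 < n.+1 <= N)%N by rewrite /= ltn_ord.
rewrite /tcoef !RE (gamt_jnormt hn) jacobiE -/(s j) mulrAC -hc ?ltn_ord //.
by rewrite mulfK // gt_eqF // jnormt_gt0.
Qed.

Lemma scoefE k j : scoef N a b x w k.+1 j = 2%:R^-1 * \sum_(n < N)
  ((n%:R + a + b + 2%:R) * conn (a + 1)%coqR (b + 1)%coqR (IZR 0) (IZR 0) k n
    * tcoef N a b x w n.+1 j).
Proof.
rewrite /scoef RmultE rsumE big_ord_recl.
have -> : Nat.leb 1 (@ord0 N) = false by [].
rewrite andbF add0r RinvE RtwoE; congr (_ * _).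
apply: eq_bigr => n _; rewrite lift0 !Nat.sub_succ !Nat.sub_0_r leqbE.
have -> : Nat.leb 1 n.+1 = true by [].
rewrite andbT; case: leqP => h; last by rewrite conn_gt ?mulr0 ?mul0r //; lia.
by rewrite !RE -natr1; congr (_ * _ * _); ring.
Qed.

(* The coefficients [s_lj] are those of [h_j'] in the Legendre basis. *)
Lemma deriv_lagp j : (j <= N)%N ->
  - 2%:R^-1 *: (lagp N s j)^`() = \sum_(k < N) scoef N a b x w k.+1 j *: jac 0 0 k.
Proof.
move=> hj; have [c0 ->] := lagp_expand hj.
rewrite derivD derivC add0r raddf_sum /= scaler_sumr.
have a2 := ltN1D1 a1; have b2 := ltN1D1 b1.
(* The inner sum, which stops at k = n, is widened to k < N by zeros of [conn], so that the two sums
   can be exchanged. *)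
transitivity (\sum_(n < N) \sum_(k < N) (2%:R^-1 * ((n%:R + a + b + 2%:R) *
   conn (a + 1)%coqR (b + 1)%coqR (IZR 0) (IZR 0) k n * tcoef N a b x w n.+1 j))
   *: jac 0 0 k : {poly R}).
  apply: eq_bigr => n _; rewrite derivZ deriv_jac // (conn_jac n a2 b2).
  rewrite (big_ord_widen N (fun k => conn (a + 1) (b + 1) (IZR 0) (IZR 0) k n
    *: jac 0 0 k)) ?ltn_ord //.
  rewrite big_mkcond !scaler_sumr; apply: eq_bigr => k _; rewrite ltnS.
  case: leqP => h; first by rewrite !scalerA; congr (_ *: _); rewrite !RE; ring.
  by rewrite conn_gt // mulr0 mul0r mulr0 !scaler0 scale0r.
rewrite exchange_big; apply: eq_bigr => k _.
by rewrite -scaler_suml scoefE mulr_sumr.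
Qed.

Lemma lagr_derivable j (y : R) : (j <= N)%N -> derivable_pt_lim (lagr N x j) y
  (rsum N (fun k => (scoef N a b x w k.+1 j * jacobi 0 0 k y)%coqR)).
Proof.
move=> hj; apply: (derivable_pt_lim_ext _ _ _ _ (fun t => esym (lagrE N x j t))).
have -> : rsum N (fun k => (scoef N a b x w k.+1 j * jacobi 0 0 k y)%coqR) =
   - 2%:R^-1 * (lagp N s j)^`().[toS y].
  rewrite -hornerZ deriv_lagp // rsumE horner_sum; apply: eq_bigr => k _.
  by rewrite hornerZ jacobiE RE.
exact: derivable_horner_toS.
Qed.

End Main.

(** * The Legendre case *)

Lemma jmom00 k : jmom 0 0 k = 2%:R / k.+1%:R.
Proof.
rewrite /jmom mass00 RtwoE R0E !add0r.
have h1 : rising (GRing.one R) k != 0 by rewrite gt_eqF // rising_gt0.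
have e : rising 2%:R k = rising 1 k * k.+1%:R :> R.
  by rewrite -[k.+1%:R]natr1 [_ + 1]addrC -risingSr risingS mul1r.
by rewrite e invfM mulVKf.
Qed.

(** The fundamental theorem of calculus on monomials; the factor 2 appears because the moments are
    taken with respect to y on [-1, 1]. *)
Lemma mom_deriv00 p : mom (jmom 0 0) p^`() = 2%:R * (p.[1] - p.[0]).
Proof.
have sp : (size p <= (size p).+1)%N by [].
have sd : (size p^`() <= size p)%N.
  have [->|p0] := eqVneq p 0; first by rewrite deriv0.
  exact: ltnW (lt_size_deriv p0).
rewrite (mom_bound _ sd) (horner_coef_wide _ sp) big_ord_recl expr0 mulr1.
rewrite horner_coef0 addrC addKr mulr_sumr; apply: eq_bigr => k _.
rewrite coef_deriv jmom00 expr1n lift0 mulr1 -mulr_natr.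
by field; rewrite addrC natr1 pnatr_eq0.
Qed.

Lemma jac00_at0 k : (jac 0 0 k).[0] = 1 :> R.
Proof.
rewrite horner_coef0 coef_jac /jcoef !rising0 fact0 !mulr1 invr1 !mulr1 add0r.
have -> : rising (GRing.one R) k = k`!%:R.
  by elim: k => [|k IH]; rewrite ?rising0 // risingSr IH factS natrM -natr1 mulrC addrC.
by rewrite divff // factr_neq0.
Qed.

Lemma jac00_at1 k : (jac 0 0 k).[1] = (-1) ^+ k :> R.
Proof.
have h0 : -1 < 0 :> R by rewrite ltrN10.
have := congr1 (horner^~ 0) (jac_reflect k h0 h0).
by rewrite /= horner_comp !hornerE subr0 jac00_at0 mulr1.
Qed.

Section Legendre.
Variables (N : nat) (x w : nat -> R).
Hypothesis N0 : (0 < N)%N.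
Hypothesis inc : forall i, (i < N)%N -> x i < x i.+1.
Hypotheses (x0 : x 0%N = -1) (xN : x N = 1).
Hypothesis nodes : forall j, (j <= N)%N -> forall d,
  derivable_pt_lim (jacobi 0 0 N) (x j) d -> (1 - x j ^+ 2) * d = 0.
Hypothesis weights : forall c : nat -> R,
  improper_int
    (fun y => (rsum (2 * N) (fun k => c k * y ^ k) * Rpower (1 - y) 0 * Rpower (1 + y) 0)%coqR)
    (IZR (-1)) (IZR 1)
    (rsum N.+1 (fun j => rsum (2 * N) (fun k => c k * x j ^ k) * w j)%coqR).

(* Pair [h_j'] with [P_k] and integrate by parts. *)
Lemma scoef_legendre k j d : (k < N)%N -> (j <= N)%N ->
  derivable_pt_lim (jacobi 0 0 k) (x j) d ->
  scoef N 0 0 x w k.+1 j = (2%:R * k%:R + 1) / 2%:R *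
    ((j == N)%:R + (-1) ^+ k.+1 * (j == 0%N)%:R - w j * d).
Proof.
move=> kN jN hd.
have h0 : -1 < 0 :> R by rewrite ltrN10.
pose s i := toS (x i); pose H := lagp N s j; pose P : {poly R} := jac 0 0 k.
have hM := pearson_jmom h0 h0.
have {hd} -> : d = - 2%:R^-1 * P^`().[s j].
  apply: (uniqueness_limite _ _ _ _ hd).
  apply: (derivable_pt_lim_ext _ _ _ _ (fun t => esym (jacobiE 0 0 k t))).
  exact: derivable_horner_toS.
(* The substitution reverses the interval: x_N = 1 goes to s = 0 and x_0 = -1 to s = 1. *)
have sN : s N = 0 by rewrite /s /toS xN subrr mul0r.
have s0 : s 0%N = 1 by rewrite /s /toS x0; field.
have node i : (i <= N)%N -> H.[s i] = (i == j)%:R.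
  by move=> hi; apply: lagp_node => // u v; exact: node_inj.
have H0 : H.[0] = (j == N)%:R by rewrite -sN node // eq_sym.
have H1 : H.[1] = (j == 0%N)%:R by have := node 0%N isT; rewrite s0 eq_sym.
have Q : quad N s w (H * P^`()) = w j * P^`().[s j].
  rewrite /quad (bigD1 (inord j)) //= inordK // hornerM node // eqxx mul1r mulrC.
  rewrite big1 ?addr0 // => i ij; rewrite hornerM node ?leq_ord //.
  case: eqP => [e|]; last by rewrite !mul0r.
  by case/eqP: ij; apply: val_inj; rewrite /= inordK.
(* The degree of H P' is below 2N, so the rule is exact on it and only node j contributes. *)
have I1 : mom (jmom 0 0) (H * P^`()) = w j * P^`().[s j].
  rewrite -Q; apply/esym/quad_exact; last first.
    apply: leq_trans (size_polyMleq _ _) _.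
    have := size_lagp s jN; rewrite -/H.
    have : (size P^`() <= k)%N.
      have := @lt_size_deriv _ P; rewrite size_jac // ltnS; apply.
      by rewrite -size_poly_eq0 size_jac.
    by move: (size _) (size _) kN => u v kN hv hu; clear -kN hv hu; lia.
  by move=> i hi; apply: quad_moment.
have I2 : mom (jmom 0 0) (- 2%:R^-1 *: H^`() * P) = scoef N 0 0 x w k.+1 j * gam 0 0 k.
  rewrite (deriv_lagp N0 h0 h0 inc nodes weights jN) mulr_suml linear_sum (bigD1 (Ordinal kN)) //=.
  rewrite -scalerAl linearZ /= jac_norm // {1}/jmom !rising0 divr1 mulr1.
  rewrite -gam_jnorm //; last by rewrite !addr0 add0r ltr01 orbT.
  rewrite big1 ?addr0 // => i ij; rewrite -scalerAl linearZ /= jac_orth ?mulr0 //.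
have gk : gam 0 0 k = 2%:R / (2%:R * k%:R + 1) by rewrite gam00 !RE.
have hk : 2%:R * k%:R + 1 != 0 :> R by rewrite -natrM natr1 pnatr_eq0.
have I3 : mom (jmom 0 0) (H * P)^`() = 2%:R * ((j == 0%N)%:R * (-1) ^+ k - (j == N)%:R).
  by rewrite mom_deriv00 !hornerM H0 H1 jac00_at0 jac00_at1 mulr1.
have : scoef N 0 0 x w k.+1 j * gam 0 0 k = (j == N)%:R + (-1) ^+ k.+1 * (j == 0%N)%:R
   - w j * (- 2%:R^-1 * P^`().[s j]).
  rewrite -I2 -scalerAl linearZ /=.
  have -> : H^`() * P = (H * P)^`() - H * P^`() by rewrite derivM addrK.
  rewrite linearB /= I1 I3 exprS; by field.
by move=> <-; rewrite gk; field.
Qed.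

End Legendre.

(** * Restatement over the standard library's order and operations *)

Lemma gtN1R (a : R) : (-1 < a)%coqR -> -1 < a.
Proof. by rewrite RN1E => /RltP. Qed.

Lemma jacobi_reflectR (a b : R) n (y : R) : (-1 < a)%coqR -> (-1 < b)%coqR ->
  (jacobi b a n (- y) = (-1) ^ n * jacobi a b n y)%coqR.
Proof. by move=> /gtN1R a1 /gtN1R b1; rewrite !RE -jacobi_reflect // RoppE. Qed.

Lemma jacobi_derivable (a b : R) n (y : R) : exists d, derivable_pt_lim (jacobi a b n) y d.
Proof.
eexists; apply: (derivable_pt_lim_ext _ _ _ _ (fun t => esym (jacobiE a b n t))).
exact: derivable_horner_toS.
Qed.

Section Interface.
Variables (N : nat) (a b : R) (x w : nat -> R).
Hypotheses (HN : (1 <= N)%coq_nat) (Ha : (-1 < a)%coqR) (Hb : (-1 < b)%coqR).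
Hypothesis Hinc : forall i, (i < N)%coq_nat -> (x i < x (S i))%coqR.
Hypothesis Hnodes : forall j, (j <= N)%coq_nat -> forall d,
  derivable_pt_lim (jacobi a b N) (x j) d -> ((1 - x j ^ 2) * d = 0)%coqR.
Hypothesis Hweights : forall c : nat -> R,
  improper_int
    (fun y => (rsum (2 * N)%coq_nat (fun k => c k * y ^ k) 
      * Rpower (1 - y) a * Rpower (1 + y) b)%coqR)
    (-1)%coqR 1%coqR
    (rsum (S N) (fun j => rsum (2 * N)%coq_nat (fun k => c k * x j ^ k) * w j)%coqR).

Let N0 : (0 < N)%N. Proof. exact/ssrnat.leP. Qed.

Let inc i : (i < N)%N -> x i < x i.+1.
Proof. by move=> /ssrnat.ltP h; apply/RltP; exact: Hinc. Qed.

Let nodes j : (j <= N)%N -> forall d,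
  derivable_pt_lim (jacobi a b N) (x j) d -> (1 - x j ^+ 2) * d = 0.
Proof. by move=> /ssrnat.leP h d hd; have := Hnodes h hd; rewrite !RE. Qed.

Lemma lagr_derivableR j (y : R) : (j <= N)%coq_nat -> derivable_pt_lim (lagr N x j) y
  (rsum N (fun k => (scoef N a b x w (S k) j * jacobi 0 0 k y)%coqR)).
Proof.
by move=> /ssrnat.leP jN; exact: (lagr_derivable N0 (gtN1R Ha) (gtN1R Hb) inc nodes Hweights).
Qed.

Hypotheses (x0 : x 0%N = (-1)%coqR) (xN : x N = 1%coqR) (a0 : a = 0%coqR) (b0 : b = 0%coqR).

Lemma scoef_legendreR l j d : (1 <= l)%coq_nat /\ (l <= N)%coq_nat -> (j <= N)%coq_nat ->
  derivable_pt_lim (jacobi 0 0 (l - 1)%coq_nat) (x j) d ->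
  (scoef N a b x w l j = (2 * INR l - 1) / 2 * (kron j N + (-1) ^ l * kron j 0 - w j * d))%coqR.
Proof.
case: l => [[h _]|k [_ /ssrnat.leP kN]]; first by inversion h.
move=> /ssrnat.leP jN; rewrite Nat.sub_succ Nat.sub_0_r => hd.
have x0' : x 0%N = (-1)%R by rewrite x0 RN1E.
move: Hweights nodes; rewrite a0 b0 => W nd.
rewrite (scoef_legendre N0 inc x0' xN nd W kN jN hd) !RE -natr1 /kron.
have E u v : Nat.eqb u v = (u == v) by apply/idP/eqP => [/Nat.eqb_eq|->]; rewrite ?Nat.eqb_refl.
rewrite !E; congr (_ / _ * _); first by ring.
by case: (j == N); case: (j == 0%N); rewrite !RE.
Qed.

End Interface.

End Transfer.

Import Lra Lia Factorial BetaGamma Transfer.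

(** * The Caputo derivative *)

Lemma frac_int_legendre x mu n : -1 < x -> 0 < mu < 1 ->
  impr (fun y => Rpower (x - y) (1 - mu - 1) * jacobi 0 0 n y) (-1) x
    (Gamma (1 - mu) * (Rpower (1 + x) (1 - mu) *
      (INR (fact n) / Gamma (INR (S n) + 1 - mu) * jacobi (mu - 1) (1 - mu) n x))).
Proof.
  intros Hx Hmu.
  set (rho := 1 - mu).
  set (C := fun k => (-1) ^ n * (poch (- INR n) k * poch (INR n + 1) k
                       / (INR (fact k) * INR (fact k)) * / 2 ^ k)).
  assert (HP : forall y, jacobi 0 0 n y = rsum (S n) (fun k => C k * (1 + y) ^ k)).
  { intros y; replace y with (- - y) at 1 by ring.
    rewrite jacobi_reflectR by lra; unfold jacobi.
    rewrite !Rplus_0_l, !Rplus_0_r, poch_1, Rdiv_diag, Rmult_1_l by apply INR_fact_neq_0.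
    rewrite <- rsum_scal; apply rsum_ext; intros k _; unfold C.
    rewrite poch_1; replace ((1 - - y) / 2) with ((1 + y) * / 2) by field.
    rewrite Rpow_mult_distr, pow_inv; ring. }
  (* The parameters mu - 1 and 1 - mu cancel in the upper parameter, leaving n + 1 as for Legendre.
     Only the lower parameter changes, from 1 to rho + 1, which is the effect of fractional
     integration on each power of 1 + y. *)
  assert (HQ : jacobi (mu - 1) (1 - mu) n x = rsum (S n) (fun k =>
     C k * (1 + x) ^ k * (poch (rho + 1) n / INR (fact n) * (INR (fact k) / poch (rho + 1) k)))).
  { replace x with (- - x) at 1 by ring.
    rewrite jacobi_reflectR by lra; unfold jacobi.
    fold rho; rewrite <- Rmult_assoc, <- rsum_scal; apply rsum_ext; intros k _; unfold C.
    replace (INR n + rho + (mu - 1) + 1) with (INR n + 1) by (unfold rho; ring).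
    replace ((1 - - x) / 2) with ((1 + x) * / 2) by field.
    rewrite Rpow_mult_distr, pow_inv.
    pose proof (poch_pos (rho + 1) k ltac:(unfold rho; lra)).
    pose proof (INR_fact_lt_0 k); pose proof (INR_fact_lt_0 n).
    assert (0 < 2 ^ k) by (apply pow_lt; lra).
    field; repeat split; lra. }
  assert (Hr : 0 < rho) by (unfold rho; lra).
  pose proof (impr_rsum (S n)
    (fun k y => C k * (Rpower (x - y) (rho - 1) * (1 + y) ^ k) +
                0 * (Rpower (x - y) (rho - 1) * (1 + y) ^ k)) _ (-1) x
    (fun k _ => impr_lin _ _ _ _ _ _ (C k) 0
      (frac_int_monomial x rho k Hx Hr) (frac_int_monomial x rho k Hx Hr))) as E.
  match type of E with impr _ _ _ ?v => match goal with |- impr _ _ _ ?u =>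
    replace u with v end end.
  - apply impr_ext with (2 := E); intros y _.
    rewrite HP, <- rsum_scal; apply rsum_ext; intros k _; unfold rho; ring.
  - fold rho in HQ; rewrite HQ, <- !rsum_scal; apply rsum_ext; intros k _.
    replace (rho + INR k + 1) with (rho + 1 + INR k) by ring.
    replace (INR (S n) + 1 - mu) with (rho + 1 + INR n) by (rewrite S_INR; unfold rho; ring).
    rewrite !Gamma_poch by lra.
    pose proof (poch_pos (rho + 1) k ltac:(lra)); pose proof (poch_pos (rho + 1) n ltac:(lra)).
    pose proof (Gamma_pos (rho + 1) ltac:(lra)); pose proof (INR_fact_lt_0 n).
    field; repeat split; lra.
Qed.

Lemma continuity_pt_rsum n (f : nat -> R -> R) y :
  (forall k, continuity_pt (f k) y) -> continuity_pt (fun t => rsum n (fun k => f k t)) y.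
Proof.
  intros H; induction n as [|n IH]; simpl.
  - apply continuity_pt_const; intros u v; reflexivity.
  - exact (continuity_pt_plus _ _ y IH (H n)).
Qed.

(* [0 ^ p = 0] by the convention of [powr]. *)
Lemma powr_mul_lim (p : R) (G : R -> R) : 0 < p -> continuity_pt G (-1) ->
  forall eps, 0 < eps -> exists delta, 0 < delta /\
    forall y, -1 < y < -1 + delta -> Rabs (powr (1 + y) p * G y - powr (1 + -1) p * G (-1)) < eps.
Proof.
  intros Hp HG eps Heps.
  replace (powr (1 + -1) p) with 0 by (unfold powr; destruct (Rlt_dec 0 (1 + -1)); lra).
  destruct (HG 1) as [d1 [Hd1 H1]]; [lra|].
  set (B := Rabs (G (-1)) + 1).
  assert (HB : 0 < B) by (unfold B; pose proof (Rabs_pos (G (-1))); lra).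
  destruct (Rpower_small p (eps / B) Hp ltac:(apply Rdiv_lt_0_compat; lra)) as [d2 [Hd2 H2]].
  exists (Rmin d1 d2); split; [apply Rmin_glb_lt; assumption|]; intros y Hy.
  pose proof (Rmin_l d1 d2); pose proof (Rmin_r d1 d2).
  assert (HG' : Rabs (G y) < B).
  { assert (E : Rabs (G y - G (-1)) < 1).
    { apply H1; split; [split; [exact I | lra]|].
      simpl; unfold Rdist; rewrite Rabs_pos_eq; lra. }
    pose proof (Rabs_triang (G y - G (-1)) (G (-1))) as T.
    replace (G y - G (-1) + G (-1)) with (G y) in T by ring; unfold B; lra. }
  assert (HR := H2 (1 + y) ltac:(lra)); pose proof (Rpower_gt0 (1 + y) p).
  unfold powr; destruct (Rlt_dec 0 (1 + y)) as [_|C]; [|lra].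
  rewrite Rmult_0_l, Rminus_0_r, Rabs_mult, (Rabs_pos_eq (Rpower _ _)) by lra.
  replace eps with (eps / B * B) by (field; lra).
  apply Rmult_le_0_lt_compat; auto; [lra | apply Rabs_pos].
Qed.

Theorem theorem3p2
  (N : nat) (HN : (1 <= N)%nat) (alpha beta : R)
  (Ha : -1 < alpha) (Hb : -1 < beta)
  (x w : nat -> R)
  (Hx0 : x 0%nat = -1) (HxN : x N = 1)
  (Hinc : forall i, (i < N)%nat -> x i < x (S i))
  (Hnodes : forall y,
     (exists i, (i <= N)%nat /\ y = x i) <->
     (forall d, derivable_pt_lim (jacobi alpha beta N) y d -> (1 - y ^ 2) * d = 0))
  (Hweights : forall c : nat -> R,
     improper_int
       (fun y => rsum (2 * N) (fun k => c k * y ^ k)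
                 * Rpower (1 - y) alpha * Rpower (1 + y) beta) (-1) 1
       (rsum (S N) (fun j => rsum (2 * N) (fun k => c k * x j ^ k) * w j)))
  (mu : R) (Hmu : 0 < mu < 1) :
  (forall i j, (1 <= i <= N)%nat -> (j <= N)%nat ->
     is_caputo mu (lagr N x j) (x i) (Dformula N alpha beta mu x w j (x i)))
  /\
  (forall j, (j <= N)%nat ->
     forall eps, 0 < eps -> exists delta, 0 < delta /\
       forall y, -1 < y < -1 + delta ->
         exists v, is_caputo mu (lagr N x j) y v /\
                   Rabs (v - Dformula N alpha beta mu x w j (x 0%nat)) < eps)
  /\
  (alpha = 0 -> beta = 0 ->
     forall l j, (1 <= l <= N)%nat -> (j <= N)%nat ->
       forall d, derivable_pt_lim (jacobi 0 0 (l - 1)) (x j) d ->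
         scoef N alpha beta x w l j =
           (2 * INR l - 1) / 2 *
           (kron j N + (-1) ^ l * kron j 0 - w j * d)).
Proof.
  assert (Hnd : forall j, (j <= N)%nat -> forall d,
    derivable_pt_lim (jacobi alpha beta N) (x j) d -> (1 - x j ^ 2) * d = 0).
  { intros j Hj; apply Hnodes; exists j; auto. }
  (* Stated for every y > -1 and not only for nodes, since the limit at x_0 needs the derivative at
     all nearby points. *)
  assert (Hcap : forall j y, (j <= N)%nat -> -1 < y ->
    is_caputo mu (lagr N x j) y (Dformula N alpha beta mu x w j y)).
  { intros j y Hj Hy.
    exists (fun t => rsum N (fun k => scoef N alpha beta x w (S k) j * jacobi 0 0 k t)); split.
    { intros t; apply lagr_derivableR; assumption. }
    pose proof (Gamma_pos (1 - mu) ltac:(lra)) as HG.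
    exists (Gamma (1 - mu) * Dformula N alpha beta mu x w j y); split; [|field; lra].
    apply improper_intE.
    pose proof (impr_rsum N _ _ (-1) y (fun k _ => impr_lin _ _ _ _ _ _
      (scoef N alpha beta x w (S k) j) 0
      (frac_int_legendre y mu k Hy Hmu) (frac_int_legendre y mu k Hy Hmu))) as E.
    match type of E with impr _ _ _ ?v => match goal with |- impr _ _ _ ?u =>
      replace u with v end end.
    - apply impr_ext with (2 := E); intros t _.
      rewrite <- rsum_scal; apply rsum_ext; intros k _; ring.
    - unfold Dformula, powr; destruct (Rlt_dec 0 (1 + y)) as [_|C]; [|lra].
      rewrite rsum_recl; simpl (Nat.eqb 0 0); rewrite Rplus_0_l, <- !rsum_scal.
      apply rsum_ext; intros k _; simpl Nat.eqb; cbv iota.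
      rewrite Nat.sub_succ, Nat.sub_0_r; ring. }
  split; [|split].
  - intros i j Hi Hj; apply Hcap; [exact Hj|].
    assert (Hlt : forall m, (m < N)%nat -> -1 < x (S m)).
    { induction m as [|m IH]; intros Hm; [rewrite <- Hx0; apply Hinc, Hm|].
      apply Rlt_trans with (x (S m)); [apply IH; lia | apply Hinc, Hm]. }
    destruct i as [|i]; [lia | apply Hlt; lia].
  - intros j Hj eps Heps; rewrite Hx0.
    (* This factor is a polynomial, hence continuous at -1, while [powr (1 + y) (1 - mu)] tends to
       0, its value at -1. *)
    set (G := fun y => rsum (S N) (fun l => if Nat.eqb l 0 then 0 else
      INR (fact (l - 1)) / Gamma (INR l + 1 - mu) * scoef N alpha beta x w l j
      * jacobi (mu - 1) (1 - mu) (l - 1) y)).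
    assert (HG : continuity_pt G (-1)).
    { apply continuity_pt_rsum; intros l; destruct (Nat.eqb l 0).
      - apply continuity_pt_const; intros u v; reflexivity.
      - apply continuity_pt_scal.
        destruct (jacobi_derivable (mu - 1) (1 - mu) (l - 1) (-1)) as [d Hd].
        apply derivable_continuous_pt; exists d; exact Hd. }
    destruct (powr_mul_lim (1 - mu) G ltac:(lra) HG eps Heps) as [delta [Hd H]].
    exists delta; split; [exact Hd|]; intros y Hy.
    exists (Dformula N alpha beta mu x w j y); split; [apply Hcap; [exact Hj | lra]|].
    exact (H y Hy).
  - intros Ha0 Hb0 l j Hl Hj d Hd; apply scoef_legendreR; assumption.
Qed.
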